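(* Let $k\ge 2$ be a natural number, let $C>0$, and let $D\subseteq\mathbb{C}$ be a domain. Then the family $$\mathcal{F}_k:=\left\{ f \text{ holomorphic in } D \;:\; \frac{|f^{(k)}(z)|}{1+|f(z)|}\le C \text{ for all } z\in D\right\}$$ is quasi-normal in $D$.
   Context: A family $\mathcal{F}$ of meromorphic functions in a domain $D\subseteq\mathbb{C}$ is called quasi-normal if from each sequence $\{f_n\}_n$ in $\mathcal{F}$ one can extract a subsequence which converges locally uniformly (with respect to the spherical metric, the limit $\infty$ being allowed) on $D\setminus E$, where the set $E$ (which may depend on the sequence) has no accumulation point in $D$. *)

(* Defs.v *)
From HB Require Import structures.
From mathcomp Require Import all_boot all_order all_algebra.
From mathcomp Require Import all_classical all_reals all_analysis.
From mathcomp Require Import complex.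
Set Implicit Arguments. Unset Strict Implicit. Unset Printing Implicit Defensive.
Import Order.TTheory GRing.Theory Num.Theory.
Import numFieldNormedType.Exports.
Local Open Scope classical_set_scope.
Local Open Scope ring_scope.
Local Open Scope complex_scope.

(* The complex plane is modelled as R[i] = complex R for R : realType;
   the point at infinity of the Riemann sphere is [None : option R[i]]. *)

(* the complex field R[i], seen as a numFieldType (hence normed module
   over itself, with its usual topology) *)
Definition Cplx (R : realType) : numFieldType := R[i].

Definition cabs (R : realType) (x : Cplx R) : R :=
  Num.sqrt (complex.Re x ^+ 2 + complex.Im x ^+ 2).

Definition chordal (R : realType) (a b : option (Cplx R)) : R :=
  match a, b with
  | Some x, Some y =>
      2 * cabs (x - y) / (Num.sqrt (1 + cabs x ^+ 2) * Num.sqrt (1 + cabs y ^+ 2))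
  | Some x, None | None, Some x => 2 / Num.sqrt (1 + cabs x ^+ 2)
  | None, None => 0
  end.

Definition domain (R : realType) (D : set (Cplx R)) := open D /\ connected D.

Definition holomorphic_on (R : realType) (D : set (Cplx R)) (f : Cplx R -> Cplx R) :=
  forall z, D z -> derivable f z 1.

Definition no_acc_point_in (R : realType) (E D : set (Cplx R)) :=
  forall z, D z -> \forall w \near z, E w -> w = z.

Definition sph_locally_uniform_cvg (R : realType) (U : set (Cplx R))
    (f : nat -> Cplx R -> Cplx R) (g : Cplx R -> option (Cplx R)) :=
  forall K : set (Cplx R), compact K -> K `<=` U ->
  forall eps : R, 0 < eps -> exists N : nat, forall n, (N <= n)%N ->
  forall z, K z -> chordal (Some (f n z)) (g z) < eps.

Definition quasi_normal (R : realType) (D : set (Cplx R)) (F : set (Cplx R -> Cplx R)) :=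
  forall f : nat -> (Cplx R -> Cplx R), (forall n, F (f n)) ->
  exists (phi : nat -> nat) (E : set (Cplx R)) (g : Cplx R -> option (Cplx R)),
    [/\ (forall n, (phi n < phi n.+1)%N),
        no_acc_point_in E D &
        sph_locally_uniform_cvg (D `\` E) (fun n => f (phi n)) g].

Definition family_Fk (R : realType) (D : set (Cplx R)) (k : nat) (C : R) :
    set (Cplx R -> Cplx R) :=
  [set f | holomorphic_on D f /\
           forall z, D z -> `|derive1n k f z| / (1 + `|f z|) <= (C%:C : Cplx R)].

(* Main.v *)
(** Near a point z of D, on a disc of radius r <= 1 with C r <= 1/2, Taylor's
    inequality turns |f^(k)| <= C (1 + |f|) into |f| <= 2 m(f) + 1, where
    m(f) = |f(z)| + |f'(z)| + ... + |f^(k-1)(z)|.  If m(f_n) is bounded along a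
    subsequence, Montel's theorem gives a locally uniform limit near z.
    Otherwise m(f_n) tends to infinity and the f_n / m(f_n) are bounded by 3, so
    a subsequence converges to a holomorphic g; g is not 0 since by Cauchy's
    estimates the first k derivatives of f_n / m(f_n) at z, whose moduli sum to 1,
    would tend to 0.  Hence the zeros of g are isolated, and off them f_n tends to
    infinity.  The size of the disc depends on z, C and D only, so countably many
    discs cover D and a diagonal subsequence serves all of them.

    Power series expansions come from Goursat's theorem on rectangles; they enter
    only as quantitative Taylor estimates on a disc ([expands]), which pass to
    pointwise limits. *)
Require Import Defs.
From HB Require Import structures.
From mathcomp Require Import all_boot all_order all_algebra.
From mathcomp Require Import all_classical all_reals all_analysis.
From mathcomp Require Import complex.
From mathcomp Require Import ring lra.
Set Implicit Arguments. Unset Strict Implicit. Unset Printing Implicit Defensive.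
Import Order.TTheory GRing.Theory Num.Theory.
Import numFieldNormedType.Exports.
Local Open Scope classical_set_scope.
Local Open Scope ring_scope.
Local Open Scope complex_scope.

(** * Complex modulus and derivatives *)

Section Modulus.
Context {R : realType}.
Local Notation C := (Cplx R).
Implicit Types z w : C.

(** The normalisation by m(f_n) only says something at the centre z, while zeros of g must be
    isolated at every point w of a disc around z. This is obtained without an identity theorem: w
    stays so close to z that the disc on which g is expanded around w contains a neighbourhood of z.
    If all coefficients at w vanished, the f_n / m(f_n) would be uniformly small near z, and
    Cauchy's estimates at z give the contradiction. The subsequence is fixed before w is chosen.
    Limits found on different discs must be glued. Convergence near a point is therefore a property
    of the subsequence alone, stable under further extraction; E consists of the points of D where
    it fails, and the limit is read off pointwise from the sequence. Since the family is defined by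
    iterated [derive1], derivatives must be shown to be differentiable again; this is done through
    limits of difference quotients, without differentiating under an integral. Contours are squares,
    so integrals reduce to increments of primitives along axis-parallel segments. The numerical
    constants record crude lengths and distances for these squares. *)

Lemma cabsE z : cabs z = ComplexField.Normc.normc z.
Proof. by case: z. Qed.

Lemma norm_cabs z : `|z| = (cabs z)%:C :> C.
Proof. exact: normc_def. Qed.

Lemma cabs_ge0 z : 0 <= cabs z. Proof. exact: sqrtr_ge0. Qed.

Lemma cabs0 : cabs (0 : C) = 0.
Proof. by rewrite cabsE ComplexField.Normc.normc0. Qed.

Lemma cabs1 : cabs (1 : C) = 1.
Proof. by rewrite cabsE ComplexField.Normc.normc1. Qed.

Lemma cabs_eq0 z : (cabs z == 0) = (z == 0).
Proof.
apply/eqP/eqP => [|->]; last exact: cabs0.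
by rewrite cabsE; apply: ComplexField.Normc.eq0_normc.
Qed.

Lemma cabs_gt0 z : (0 < cabs z) = (z != 0).
Proof. by rewrite lt_neqAle cabs_ge0 andbT eq_sym cabs_eq0. Qed.

Lemma cabsM z w : cabs (z * w) = cabs z * cabs w.
Proof. by rewrite !cabsE ComplexField.Normc.normcM. Qed.

Lemma cabsV z : cabs z^-1 = (cabs z)^-1.
Proof. by rewrite !cabsE ComplexField.Normc.normcV. Qed.

Lemma cabsX z n : cabs (z ^+ n) = cabs z ^+ n.
Proof.
elim: n => [|n IH]; first by rewrite !expr0 cabs1.
by rewrite !exprS cabsM IH.
Qed.

Lemma cabsN z : cabs (- z) = cabs z.
Proof. by rewrite !cabsE normcN. Qed.

Lemma cabsBC z w : cabs (z - w) = cabs (w - z).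
Proof. by rewrite -cabsN opprB. Qed.

Lemma cabsD z w : cabs (z + w) <= cabs z + cabs w.
Proof. by rewrite !cabsE; apply: le_normcD. Qed.

Lemma cabsB z w : cabs (z - w) <= cabs z + cabs w.
Proof. by rewrite -(cabsN w); apply: cabsD. Qed.

Lemma cabs_sub_ge z w : cabs z - cabs w <= cabs (z - w).
Proof. by rewrite lerBlDr; have := cabsD (z - w) w; rewrite subrK. Qed.

Lemma cabs_trans (x y z : C) : cabs (x - z) <= cabs (x - y) + cabs (y - z).
Proof. by have := cabsD (x - y) (y - z); rewrite addrA subrK. Qed.

Lemma cabs_real (x : R) : cabs (x%:C : C) = `|x|.
Proof. by rewrite /cabs /= expr0n /= addr0 sqrtr_sqr. Qed.

Lemma cabs_sqr z : cabs z ^+ 2 = complex.Re z ^+ 2 + complex.Im z ^+ 2.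
Proof. by rewrite sqr_sqrtr // addr_ge0 ?sqr_ge0. Qed.

Lemma cabs_Re z : `|complex.Re z| <= cabs z.
Proof. by rewrite -ler_sqr ?nnegrE ?cabs_ge0// real_normK ?num_real// cabs_sqr lerDl sqr_ge0. Qed.

Lemma cabs_Im z : `|complex.Im z| <= cabs z.
Proof. by rewrite -ler_sqr ?nnegrE ?cabs_ge0// real_normK ?num_real// cabs_sqr lerDr sqr_ge0. Qed.

Lemma cabs_le_ReIm z : cabs z <= `|complex.Re z| + `|complex.Im z|.
Proof.
rewrite -ler_sqr ?nnegrE ?cabs_ge0 ?addr_ge0// cabs_sqr.
by rewrite sqrrD !real_normK ?num_real// addrAC lerDl pmulrn_lge0 // mulr_ge0.
Qed.

Lemma cabs_i : cabs ('i%C : C) = 1.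
Proof. by rewrite /cabs /= expr0n expr1n /= add0r sqrtr1. Qed.

(** The norm on [Cplx R] takes its values in [Cplx R], so the radii of balls are complex numbers;
    from here on all radii and tolerances are real. *)
Lemma nearCP z (P : set C) : (\forall w \near z, P w) <->
  exists2 d : R, 0 < d & forall w, cabs (w - z) < d -> P w.
Proof.
split.
- move=> /nbhs_ballP [e /= e0 He].
  have er : e \is Num.real by rewrite realE ltW.
  move: er e0 He => /complex_realP [k ->]; rewrite ltcR => k0 He.
  exists k => // w zw; apply: He; rewrite /ball/= norm_cabs cabsBC.
  by rewrite ltcR.
- move=> [d d0 H]; apply/nbhs_ballP; exists (d%:C : C) => /=; first by rewrite ltcR.
  by move=> w; rewrite /ball/= norm_cabs ltcR cabsBC => /H.
Qed.

Lemma open_cball (D : set C) z : open D -> D z ->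
  exists2 d : R, 0 < d & forall w, cabs (w - z) < d -> D w.
Proof. by rewrite openE => oD /oD; rewrite /interior => /nearCP. Qed.

Definition ccont (f : C -> C) z := forall e : R, 0 < e ->
  exists2 d : R, 0 < d & forall w, cabs (w - z) < d -> cabs (f w - f z) < e.

(** The multiplied-out form needs no division and no punctured neighbourhood, since it is trivially
    true at w = z. *)
Definition cderiv (f : C -> C) z (d : C) := forall e : R, 0 < e ->
  exists2 r : R, 0 < r & forall w, cabs (w - z) < r ->
    cabs (f w - f z - d * (w - z)) <= e * cabs (w - z).

Lemma cderivP f z d : cderiv f z d <-> is_derive (z : C) (1 : C) f d.
Proof.
split.
- move=> H.
  have Hc : (fun h : C => h^-1 *: ((f \o shift z) (h *: 1) - f z)) @ 0^' --> d.
    apply/cvgrPdist_le => e e0.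
    have er : e \is Num.real by rewrite realE ltW.
    move: er e0 => /complex_realP [k ->] /=; rewrite ltcR => k0.
    have [r r0 Hr] := H _ k0.
    apply/nearCP; exists r => // h; rewrite subr0 => hr h0.
    rewrite norm_cabs lecR /=.
    have h0' : cabs h != 0 by rewrite cabs_eq0.
    have -> : (h *: 1 : C) = h by rewrite /GRing.scale /= mulr1.
    rewrite cabsBC.
    have -> : h^-1 *: (f (h + z) - f z) - d = h^-1 * (f (h + z) - f z - d * (h + z - z)).
      by rewrite /GRing.scale /= addrK [RHS]mulrBr [d * h]mulrC mulKf.
    rewrite cabsM cabsV ler_pdivrMl ?cabs_gt0//.
    by rewrite addrK [leRHS]mulrC; have := Hr (h + z); rewrite addrK; apply.
  by apply: DeriveDef; [apply/cvg_ex; exists d|apply/cvg_lim].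
- case=> H /[dup] Hv <- e e0.
  have /cvgrPdist_le/(_ (e%:C)) := H.
  rewrite ltcR e0 => /(_ isT) /nearCP [r r0 Hr].
  exists r => // w wr; have [->|wz] := eqVneq w z.
    by rewrite !subrr mulr0 subr0 !cabs0 mulr0.
  have h0 : w - z != 0 by rewrite subr_eq0.
  have := Hr (w - z); rewrite subr0 => /(_ wr h0).
  rewrite norm_cabs lecR /=.
  have -> : ((w - z) *: 1 : C) = w - z by rewrite /GRing.scale /= mulr1.
  rewrite subrK cabsBC -/('D_1 f z); move: ('D_1 f z) => c.
  have -> : c - (w - z)^-1 *: (f w - f z) = (w - z)^-1 * (c * (w - z) - (f w - f z)).
    by rewrite /GRing.scale /= [RHS]mulrBr [_ * (w - z)]mulrC mulKf.
  by rewrite cabsM cabsV ler_pdivrMl ?cabs_gt0// [_ * e]mulrC.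
Qed.

Lemma cderiv_derive1 f z d : cderiv f z d -> derive1 f z = d.
Proof. by move=> /cderivP H; rewrite derive1E derive_val. Qed.

Lemma derivable_cderiv f z : derivable f z 1 -> cderiv f z (derive1 f z).
Proof. by move=> /derivableP; rewrite derive1E => /cderivP. Qed.

Lemma cderiv_cont f z d : cderiv f z d -> ccont f z.
Proof.
move=> H e e0; have [r r0 Hr] := H 1 ltr01.
have K0 : 0 < 1 + cabs d by have := cabs_ge0 d; lra.
exists (Num.min r (e / (1 + cabs d))); first by rewrite lt_min r0 divr_gt0.
move=> w; rewrite lt_min => /andP[wr we].
have := Hr _ wr; have := cabs_sub_ge (f w - f z) (d * (w - z)).
rewrite cabsM; move: we; rewrite ltr_pdivlMr//.
nra.
Qed.

Lemma eq_cderiv (f g : C -> C) z d : (\forall w \near z, f w = g w) ->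
  cderiv f z d -> cderiv g z d.
Proof.
move=> /nearCP[r r0 E] H e e0; have [r' r'0 Hr] := H e e0.
exists (Num.min r r'); first by rewrite lt_min r0.
move=> w; rewrite lt_min => /andP[/E <- /Hr].
by rewrite (E z)// subrr cabs0.
Qed.

Lemma cderiv_cst (c : C) z : cderiv (fun=> c) z 0.
Proof. by apply/cderivP; apply: is_derive_cst. Qed.

Lemma cderiv_id z : cderiv (fun w => w) z 1.
Proof. by apply/cderivP; apply: is_derive_id. Qed.

Lemma cderivD f g z a b : cderiv f z a -> cderiv g z b ->
  cderiv (fun w => f w + g w) z (a + b).
Proof. by move=> /cderivP ? /cderivP ?; apply/cderivP; apply: is_deriveD. Qed.

Lemma cderivM f g z a b : cderiv f z a -> cderiv g z b ->
  cderiv (fun w => f w * g w) z (f z * b + g z * a).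
Proof. by move=> /cderivP ? /cderivP ?; apply/cderivP; apply: is_deriveM. Qed.

Lemma cderivZ f z (c a : C) : cderiv f z a -> cderiv (fun w => c * f w) z (c * a).
Proof.
by move=> H; have := cderivM (cderiv_cst c z) H; rewrite mulr0 addr0.
Qed.

Lemma cderivB f g z a b : cderiv f z a -> cderiv g z b ->
  cderiv (fun w => f w - g w) z (a - b).
Proof.
move=> ? /(cderivZ (-1)) Hg; have -> : (fun w => f w - g w) = (fun w => f w + -1 * g w).
  by apply/funext => w; rewrite mulN1r.
by rewrite -[- b]mulN1r; apply: cderivD.
Qed.

Lemma cderivV f z a : f z != 0 -> cderiv f z a ->
  cderiv (fun w => (f w)^-1) z (- (f z) ^- 2 * a).
Proof.
move=> fz /cderivP H; apply/cderivP.
have [dV eV] : derivable (fun w => (f w)^-1) z 1 /\ 'D_1 (fun w => (f w)^-1) z = - (f z) ^- 2 * a.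
  split; first by apply: derivableV => //; case: H.
  by rewrite deriveV//; case: H => // ? ->.
exact: DeriveDef.
Qed.

Lemma cderivX f z a n : cderiv f z a ->
  cderiv (fun w => f w ^+ n) z (n%:R * f z ^+ n.-1 * a).
Proof.
move=> /cderivP H; apply/cderivP; have := is_deriveX n H.
by congr is_derive; apply/funext => w; rewrite exprfctE.
Qed.

Lemma cderiv_shift f (c : C) z a : cderiv f (z + c) a -> cderiv (fun w => f (w + c)) z a.
Proof.
move=> H e /H [r r0 Hr]; exists r => // w wr.
have E : w + c - (z + c) = w - z by rewrite opprD addrACA subrr addr0.
by have := Hr (w + c); rewrite E; apply.
Qed.

Lemma ccontM f g z : ccont f z -> ccont g z -> ccont (fun w => f w * g w) z.
Proof.
move=> Hf Hg e e0.
pose K := 1 + cabs (f z) + cabs (g z).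
have fz0 := cabs_ge0 (f z); have gz0 := cabs_ge0 (g z).
have K0 : 0 < K by rewrite /K; lra.
have e'0 : 0 < Num.min 1 (e / (2 * K)) by rewrite lt_min ltr01 divr_gt0// mulr_gt0.
have [d d0 Hd] := Hf _ e'0; have [d' d'0 Hd'] := Hg _ e'0.
exists (Num.min d d'); first by rewrite lt_min d0.
move=> w; rewrite lt_min => /andP[/Hd + /Hd'].
rewrite !lt_min !ltr_pdivlMr ?mulr_gt0// => /andP[f1 f2] /andP[g1 g2].
have -> : f w * g w - f z * g z = (f w - f z) * (g w - g z) + f z * (g w - g z) + (f w - f z) * g z by ring.
have := cabsD ((f w - f z) * (g w - g z) + f z * (g w - g z)) ((f w - f z) * g z).
have := cabsD ((f w - f z) * (g w - g z)) (f z * (g w - g z)).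
rewrite !cabsM; move: f1 f2 g1 g2.
have := cabs_ge0 (f w - f z); have := cabs_ge0 (g w - g z).
set x := cabs (f w - f z); set y := cabs (g w - g z); rewrite /K => x0 y0 *; nra.
Qed.

End Modulus.

(** * Integrals along segments *)

Section RealPaths.
Context {R : realType}.
Local Notation C := (Cplx R).
Implicit Types a b s t x y M : R.

Lemma nearRP (t : R) (P : set R) : (\forall s \near t, P s) <->
  exists2 d : R, 0 < d & forall s, `|s - t| < d -> P s.
Proof.
split=> [/nbhs_ballP [e /= e0 He]|[d d0 H]].
  by exists e => // s st; apply: He; rewrite /ball/= distrC.
by apply/nbhs_ballP; exists d => // s; rewrite /ball/= distrC => /H.
Qed.

Lemma is_derive_eps (g : R -> R) (t d : R) :
  (forall e : R, 0 < e -> exists2 r : R, 0 < r & forall s, `|s - t| < r ->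
    `|g s - g t - d * (s - t)| <= e * `|s - t|) <-> is_derive (t : R) (1 : R) g d.
Proof.
split.
- move=> H.
  have Hc : (fun h : R => h^-1 *: ((g \o shift t) (h *: 1) - g t)) @ 0^' --> d.
    apply/cvgrPdist_le => e e0.
    have [r r0 Hr] := H _ e0.
    apply/nearRP; exists r => // h; rewrite subr0 => hr h0.
    rewrite /= [h%:A]mulr1 distrC.
    have -> : h^-1 *: (g (h + t) - g t) - d = h^-1 * (g (h + t) - g t - d * (h + t - t)).
      by rewrite /GRing.scale /= addrK [RHS]mulrBr [d * h]mulrC mulKf.
    rewrite normrM normfV ler_pdivrMl ?normr_gt0//.
    by rewrite addrK [leRHS]mulrC; have := Hr (h + t); rewrite addrK; apply.
  by apply: DeriveDef; [apply/cvg_ex; exists d|apply/cvg_lim].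
- case=> H /[dup] Hv <- e e0.
  have /cvgrPdist_le/(_ e e0) := H.
  move=> /nearRP [r r0 Hr].
  exists r => // w wr; have [->|wz] := eqVneq w t.
    by rewrite !subrr mulr0 subr0 !normr0 mulr0.
  have h0 : w - t != 0 by rewrite subr_eq0.
  have := Hr (w - t); rewrite subr0 => /(_ wr h0).
  rewrite /= [(w - t)%:A]mulr1 subrK -/('D_1 g t); move: ('D_1 g t) => c.
  have -> : c - (w - t)^-1 *: (g w - g t) = (w - t)^-1 * (c * (w - t) - (g w - g t)).
    by rewrite /GRing.scale /= [RHS]mulrBr [_ * (w - t)]mulrC mulKf.
  by rewrite normrM normfV ler_pdivrMl ?normr_gt0// [_ * e]mulrC distrC.
Qed.

Definition rcont (u : R -> C) t := forall e : R, 0 < e ->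
  exists2 d : R, 0 < d & forall s, `|s - t| < d -> cabs (u s - u t) < e.

Definition rderiv (u : R -> C) t (d : C) := forall e : R, 0 < e ->
  exists2 r : R, 0 < r & forall s, `|s - t| < r ->
    cabs (u s - u t - (s - t)%:C * d) <= e * `|s - t|.

Lemma rderivD u v t (a b : C) : rderiv u t a -> rderiv v t b ->
  rderiv (fun s => u s + v s) t (a + b).
Proof.
move=> Hu Hv e e0; have e20 : 0 < e / 2 by lra.
have [r r0 Hr] := Hu _ e20; have [r' r'0 Hr'] := Hv _ e20.
exists (Num.min r r'); first by rewrite lt_min r0.
move=> s; rewrite lt_min => /andP[/Hr h1 /Hr' h2].
have -> : u s + v s - (u t + v t) - (s - t)%:C * (a + b) =
  (u s - u t - (s - t)%:C * a) + (v s - v t - (s - t)%:C * b) by ring.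
apply: le_trans (cabsD _ _) _; lra.
Qed.

Lemma rderivZ u t (c a : C) : rderiv u t a -> rderiv (fun s => c * u s) t (c * a).
Proof.
move=> Hu e e0; have K0 : 0 < 1 + cabs c by have := cabs_ge0 c; lra.
have [r r0 Hr] := Hu _ (divr_gt0 e0 K0); exists r => // s /Hr.
have -> : c * u s - c * u t - (s - t)%:C * (c * a) = c * (u s - u t - (s - t)%:C * a) by ring.
rewrite cabsM mulrAC ler_pdivlMr// mulrDr mulr1 [cabs c * _]mulrC.
by have := cabs_ge0 (u s - u t - (s - t)%:C * a); have := cabs_ge0 c; lra.
Qed.

Lemma rderiv_Re u t (d c : C) : rderiv u t d ->
  is_derive (t : R) (1 : R) (fun s => complex.Re (c * u s : C)) (complex.Re (c * d : C)).
Proof.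
move=> /(rderivZ c) H; apply/is_derive_eps => e /H [r r0 Hr].
exists r => // s /Hr; apply: le_trans.
apply: le_trans (cabs_Re _); rewrite le_eqVlt; apply/orP; left; apply/eqP.
congr (`| _ |); move: (c * u s) (c * u t) (c * d) => [x1 y1] [x2 y2] [x3 y3] /=.
ring.
Qed.

Lemma cabs_conjM (z : C) : complex.Re (z^*%C * z : C) = cabs z ^+ 2.
Proof. by rewrite cabs_sqr; case: z => x y /=; ring. Qed.

Lemma cabs_conj (z : C) : cabs (z^*%C : C) = cabs z.
Proof. by case: z => x y; rewrite /cabs /= sqrrN. Qed.

(* Rotating the increment onto the real axis reduces to the real mean value theorem. *)
Lemma mean_value_ineq a b (u U : R -> C) M : a <= b ->
  (forall t : R, a <= t <= b -> rderiv U t (u t)) ->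
  (forall t : R, a <= t <= b -> cabs (u t) <= M) ->
  cabs (U b - U a) <= M * (b - a).
Proof.
move=> ab HU HM; set W := U b - U a.
have [->|W0] := eqVneq W 0.
  rewrite cabs0; apply: mulr_ge0; last by lra.
  by apply: le_trans (HM a _); rewrite ?cabs_ge0// lexx ab.
have Hd (t : R) : a <= t <= b -> is_derive (t : R) (1 : R)
    (fun s => complex.Re (W^*%C * U s : C)) (complex.Re (W^*%C * u t : C)).
  by move=> /HU; apply: rderiv_Re.
have [||c] := @MVT_segment R (fun s => complex.Re (W^*%C * U s : C))
  (fun t : R => complex.Re (W^*%C * u t : C)) a b ab.
- by move=> x; rewrite in_itv /= => /andP[ax xb]; apply: Hd; rewrite !ltW.
- apply: derivable_within_continuous => x; rewrite in_itv /= => xab.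
  by have [] := Hd _ xab.
rewrite in_itv /= => cab.
have -> : complex.Re (W^*%C * U b : C) - complex.Re (W^*%C * U a : C) = cabs W ^+ 2.
  rewrite -cabs_conjM /W; move: (U a) (U b) => [x1 y1] [x2 y2] /=; ring.
have : complex.Re (W^*%C * u c : C) <= cabs W * M.
  apply: le_trans (ler_norm _) _; apply: le_trans (cabs_Re _) _.
  by rewrite cabsM cabs_conj ler_wpM2l ?cabs_ge0// HM.
have Wp : 0 < cabs W by rewrite cabs_gt0.
move=> h1 h2; have : cabs W * cabs W <= cabs W * (M * (b - a)).
  by rewrite -expr2 h2 mulrA ler_wpM2r ?subr_ge0.
by rewrite ler_pM2l.
Qed.

Lemma real_primitive_exists (g : R -> R) a b : continuous g ->
  exists G : R -> R, forall t : R, a <= t <= b -> is_derive (t : R) (1 : R) G (g t).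
Proof.
move=> cg.
(* The interval is enlarged by 1 on both sides so that every t in [a, b] is interior and the
   derivative is two-sided at a and b as well. *)
have gi : (@lebesgue_measure R).-integrable `[a - 1, b + 1] (EFin \o g).
  apply: continuous_compact_integrable; first exact: segment_compact.
  exact: continuous_subspaceT.
exists (fun x => \int[@lebesgue_measure R]_(t in `[a - 1, x]) g t) => t /andP[at' tb].
have tb1 : t < b + 1 by lra.
have ta1 : a - 1 < t by lra.
have := continuous_FTC1_closed tb1 gi ta1 (cg t).
move=> [d1 d2].
by apply: DeriveDef; [exact: d1|rewrite -d2; exact/esym/derive1E].
Qed.

Definition is_prim a b (u U : R -> C) := forall t : R, a <= t <= b -> rderiv U t (u t).

(** Precomposition with this 1-Lipschitz retraction extends a path on [a, b] by constants, which
    yields the global continuity that [real_primitive_exists] asks for. *)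
Let clamp a b (t : R) := Num.max a (Num.min b t).

Let clamp_lip a b s t : `|clamp a b s - clamp a b t| <= `|s - t|.
Proof.
have h1 := ler_norm (s - t); have h2 := ler_norm (t - s); rewrite distrC in h2.
have h0 := normr_ge0 (s - t); rewrite ler_norml; move: h0 h1 h2; set N := `|s - t|.
rewrite /clamp /Num.max /Num.min => h0 h1 h2.
by case: (ltP b s) => ?; case: (ltP b t) => ?; do 2 case: ltP => ?; apply/andP; split; lra.
Qed.

Lemma prim_exists a b (u : R -> C) : a <= b ->
  (forall t : R, a <= t <= b -> rcont u t) -> exists U, is_prim a b u U.
Proof.
move=> ab cu; pose v := u \o clamp a b.
have clampE (t : R) : a <= t <= b -> clamp a b t = t.
  move=> /andP[at' tb]; rewrite /clamp /Num.min; case: ltP => [?|bt]; first by exfalso; lra.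
  by rewrite /Num.max; case: ltP => // ta; apply/le_anti; rewrite at' ta.
have clamp_in (t : R) : a <= clamp a b t <= b.
  rewrite /clamp /Num.max /Num.min.
  by case: (ltP b t) => ?; case: ltP => ?; apply/andP; split; lra.
have cv (t : R) : rcont v t.
  move=> e e0; have [d d0 Hd] := cu _ (clamp_in t) _ e0.
  by exists d => // s st; apply: Hd; apply: le_lt_trans st; apply: clamp_lip.
have cRe : continuous (fun t : R => complex.Re (v t : C)).
  move=> t; apply/cvgrPdist_lt => e e0; have [d d0 Hd] := cv t _ e0.
  apply/nearRP; exists d => // s /Hd; apply: le_lt_trans; rewrite distrC.
  by apply: le_trans (cabs_Re _); case: (v s) (v t) => [x y] [x' y'] /=.
have cIm : continuous (fun t : R => complex.Im (v t : C)).
  move=> t; apply/cvgrPdist_lt => e e0; have [d d0 Hd] := cv t _ e0.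
  apply/nearRP; exists d => // s /Hd; apply: le_lt_trans; rewrite distrC.
  by apply: le_trans (cabs_Im _); case: (v s) (v t) => [x y] [x' y'] /=.
have [G1 HG1] := real_primitive_exists a b cRe.
have [G2 HG2] := real_primitive_exists a b cIm.
exists (fun t => (G1 t +i* G2 t)%C) => t tab e e0; have e20 : 0 < e / 2 by lra.
have /is_derive_eps/(_ _ e20) [r r0 Hr] := HG1 t tab.
have /is_derive_eps/(_ _ e20) [r' r'0 Hr'] := HG2 t tab.
exists (Num.min r r'); first by rewrite lt_min r0.
move=> s; rewrite lt_min => /andP[/Hr h1 /Hr' h2].
apply: le_trans (cabs_le_ReIm _) _.
move: h1 h2; rewrite /v /= clampE//; case: (u t) => [x y] /=.
rewrite !mul0r ?addr0 ?subr0 ![_ * (s - t)]mulrC; lra.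
Qed.

(* The increment of a primitive; junk if [u] has no primitive on [a, b]. *)
Definition Jint a b (u : R -> C) : C :=
  let U := xget (fun=> 0) [set U | is_prim a b u U] in U b - U a.

(** Two primitives differ by a function of derivative 0, whose increment vanishes by the mean value
    inequality with bound 0. *)
Lemma JintE a b u U : a <= b -> is_prim a b u U -> Jint a b u = U b - U a.
Proof.
move=> ab HU; rewrite /Jint; case: xgetP => [V _ /= HV|/(_ U)//].
apply/eqP; rewrite -subr_eq0 -cabs_eq0 eq_le cabs_ge0 andbT.
have -> : V b - V a - (U b - U a) = (V b + -1 * U b) - (V a + -1 * U a) by ring.
have := @mean_value_ineq a b (fun=> 0) (fun t => V t + -1 * U t) 0 ab; rewrite mul0r; apply.
- move=> t tab; have -> : 0 = u t + -1 * u t by ring.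
  by apply: rderivD (HV _ tab) (rderivZ _ (HU _ tab)).
- by move=> t _; rewrite cabs0.
Qed.

Section Jint_theory.
Variables (a b : R) (ab : a <= b).
Let cts u := forall t : R, a <= t <= b -> rcont u t.

Lemma JintD u v : cts u -> cts v -> Jint a b (fun t => u t + v t) = Jint a b u + Jint a b v.
Proof.
move=> /(prim_exists ab) [U HU] /(prim_exists ab) [V HV].
rewrite (JintE ab HU) (JintE ab HV) (@JintE _ _ _ (fun t => U t + V t))//; first by ring.
by move=> t tab; apply: rderivD; [apply: HU|apply: HV].
Qed.

Lemma JintZ (c : C) u : cts u -> Jint a b (fun t => c * u t) = c * Jint a b u.
Proof.
move=> /(prim_exists ab) [U HU].
rewrite (JintE ab HU) (@JintE _ _ _ (fun t => c * U t))//; first by ring.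
by move=> t tab; apply: rderivZ; apply: HU.
Qed.

Lemma Jint_bound u M : cts u -> (forall t : R, a <= t <= b -> cabs (u t) <= M) ->
  cabs (Jint a b u) <= M * (b - a).
Proof.
move=> /(prim_exists ab) [U HU] HM; rewrite (JintE ab HU).
exact: mean_value_ineq HU HM.
Qed.

Lemma Jint_chasles m u : a <= m <= b -> cts u -> Jint a b u = Jint a m u + Jint m b u.
Proof.
move=> /andP[am mb] /(prim_exists ab) [U HU].
rewrite (JintE ab HU) (@JintE _ _ _ U)// => [|t /andP[? ?]]; last by apply: HU; lra.
rewrite (@JintE _ _ _ U)// => [|t /andP[? ?]]; last by apply: HU; lra.
ring.
Qed.

End Jint_theory.

Definition pt (x y : R) : C := (x +i* y)%C.

Lemma ccont_h (f : C -> C) x y : ccont f (pt x y) -> rcont (fun t => f (pt t y)) x.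
Proof.
move=> H e /H [d d0 Hd]; exists d => // s sx; apply: Hd.
by rewrite /cabs /= subrr expr0n /= addr0 sqrtr_sqr.
Qed.

Lemma ccont_v (f : C -> C) x y : ccont f (pt x y) -> rcont (fun t => f (pt x t)) y.
Proof.
move=> H e /H [d d0 Hd]; exists d => // s sx; apply: Hd.
by rewrite /cabs /= subrr expr0n /= add0r sqrtr_sqr.
Qed.

Lemma cderiv_line (f : C -> C) z v d t : cderiv f (z + t%:C * v) d ->
  rderiv (fun s : R => f (z + s%:C * v)) t (v * d).
Proof.
move=> H e e0; have K0 : 0 < 1 + cabs v by have := cabs_ge0 v; lra.
have [r r0 Hr] := H _ (divr_gt0 e0 K0).
exists (r / (1 + cabs v)); first by rewrite divr_gt0.
move=> s; rewrite ltr_pdivlMr// => sr.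
have E : z + s%:C * v - (z + t%:C * v) = (s - t)%:C * v by rewrite rmorphB; ring.
have vs : cabs ((s - t)%:C * v) = `|s - t| * cabs v by rewrite cabsM cabs_real.
have v0 := cabs_ge0 v; have st0 := normr_ge0 (s - t).
have := Hr (z + s%:C * v); rewrite E vs.
have lt : `|s - t| * cabs v < r by apply: le_lt_trans sr; lra.
move=> /(_ lt).
have -> : d * ((s - t)%:C * v) = (s - t)%:C * (v * d) by ring.
move=> /le_trans; apply; rewrite mulrAC ler_pdivrMr//.
by rewrite -mulrA ler_pM2l//; lra.
Qed.

Lemma cderiv_h (f : C -> C) x y d : cderiv f (pt x y) d -> rderiv (fun t => f (pt t y)) x d.
Proof.
have E t : pt t y = pt 0 y + t%:C * 1 by rewrite /pt mulr1; apply/eqP; rewrite eq_complex /= addr0 add0r !eqxx.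
rewrite (E x) => /cderiv_line; rewrite mul1r.
by under eq_fun do rewrite -E.
Qed.

Lemma cderiv_v (f : C -> C) x y d : cderiv f (pt x y) d ->
  rderiv (fun t => f (pt x t)) y ('i%C * d).
Proof.
have E t : pt x t = pt x 0 + t%:C * 'i%C.
  by apply/eqP; rewrite eq_complex /= !mul0r !mulr0 mulr1 subr0 !addr0 !add0r !eqxx.
rewrite (E y) => /cderiv_line.
by under eq_fun do rewrite -E.
Qed.

End RealPaths.

(** * Goursat's theorem *)

Section ContourIntegrals.
Context {R : realType}.
Local Notation C := (Cplx R).
Implicit Types (a b c d x y m M e : R) (z w : C) (f g : C -> C).

Definition in_rect a b c d z :=
  (a <= complex.Re z <= b) && (c <= complex.Im z <= d).

Definition in_bdry a b c d z := in_rect a b c d z &&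
  [|| complex.Re z == a, complex.Re z == b, complex.Im z == c | complex.Im z == d].

Lemma bdry_rect a b c d z : in_bdry a b c d z -> in_rect a b c d z.
Proof. by case/andP. Qed.

Lemma in_rect_sub a b c d a' b' c' d' z : a <= a' -> b' <= b -> c <= c' -> d' <= d ->
  in_rect a' b' c' d' z -> in_rect a b c d z.
Proof.
move=> aa bb cc dd /andP[/andP[z1 z2] /andP[z3 z4]].
by rewrite /in_rect (le_trans aa) // (le_trans z2) // (le_trans cc) // (le_trans z4).
Qed.

(* The boundary of [a, b] x [c, d], counterclockwise. *)
Definition oint a b c d f : C :=
  (Jint a b (fun x => f (pt x c)) - Jint a b (fun x => f (pt x d)))
  + 'i%C * (Jint c d (fun y => f (pt b y)) - Jint c d (fun y => f (pt a y))).

Lemma cderiv_eq f z k k' : cderiv f z k -> k = k' -> cderiv f z k'.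
Proof. by move=> ? <-. Qed.

Section Rectangle.
Variables (a b c d : R) (ab : a <= b) (cd : c <= d).

Let bdryD t : a <= t <= b -> in_bdry a b c d (pt t c).
Proof. by move=> h; rewrite /in_bdry /in_rect /= h lexx cd eqxx !orbT. Qed.
Let bdryU t : a <= t <= b -> in_bdry a b c d (pt t d).
Proof. by move=> h; rewrite /in_bdry /in_rect /= h lexx cd eqxx !orbT. Qed.
Let bdryL t : c <= t <= d -> in_bdry a b c d (pt a t).
Proof. by move=> h; rewrite /in_bdry /in_rect /= h lexx ab eqxx. Qed.
Let bdryR t : c <= t <= d -> in_bdry a b c d (pt b t).
Proof. by move=> h; rewrite /in_bdry /in_rect /= h lexx ab eqxx !orbT. Qed.

Definition bdry_cont f := forall z, in_bdry a b c d z -> ccont f z.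

Let ctD f : bdry_cont f -> forall t, a <= t <= b -> rcont (fun x => f (pt x c)) t.
Proof. by move=> cf t /bdryD/cf/ccont_h. Qed.
Let ctU f : bdry_cont f -> forall t, a <= t <= b -> rcont (fun x => f (pt x d)) t.
Proof. by move=> cf t /bdryU/cf/ccont_h. Qed.
Let ctL f : bdry_cont f -> forall t, c <= t <= d -> rcont (fun y => f (pt a y)) t.
Proof. by move=> cf t /bdryL/cf/ccont_v. Qed.
Let ctR f : bdry_cont f -> forall t, c <= t <= d -> rcont (fun y => f (pt b y)) t.
Proof. by move=> cf t /bdryR/cf/ccont_v. Qed.

Lemma ointD f g : bdry_cont f -> bdry_cont g ->
  oint a b c d (fun z => f z + g z) = oint a b c d f + oint a b c d g.
Proof.
move=> cf cg; rewrite /oint.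
rewrite (JintD ab (ctD cf) (ctD cg)) (JintD ab (ctU cf) (ctU cg)).
rewrite (JintD cd (ctL cf) (ctL cg)) (JintD cd (ctR cf) (ctR cg)).
ring.
Qed.

Lemma ointZ f (k : C) : bdry_cont f ->
  oint a b c d (fun z => k * f z) = k * oint a b c d f.
Proof.
move=> cf; rewrite /oint.
rewrite (JintZ ab k (ctD cf)) (JintZ ab k (ctU cf)).
rewrite (JintZ cd k (ctL cf)) (JintZ cd k (ctR cf)).
ring.
Qed.

Lemma oint_bound f M : bdry_cont f -> (forall z, in_bdry a b c d z -> cabs (f z) <= M) ->
  cabs (oint a b c d f) <= 2 * M * ((b - a) + (d - c)).
Proof.
move=> cf Mf; rewrite /oint.
have h1 := Jint_bound ab (ctD cf) (fun t h => Mf _ (bdryD h)).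
have h2 := Jint_bound ab (ctU cf) (fun t h => Mf _ (bdryU h)).
have h3 := Jint_bound cd (ctL cf) (fun t h => Mf _ (bdryL h)).
have h4 := Jint_bound cd (ctR cf) (fun t h => Mf _ (bdryR h)).
apply: le_trans (cabsD _ _) _; rewrite cabsM cabs_i mul1r.
apply: le_trans (lerD (cabsB _ _) (cabsB _ _)) _.
lra.
Qed.

Lemma oint_deriv (U f : C -> C) : (forall z, in_bdry a b c d z -> cderiv U z (f z)) ->
  oint a b c d f = 0.
Proof.
move=> HU; rewrite /oint.
rewrite (JintE (U := fun x => U (pt x c)) ab); last by move=> t /bdryD/HU/cderiv_h.
rewrite (JintE (U := fun x => U (pt x d)) ab); last by move=> t /bdryU/HU/cderiv_h.
have i2 : 'i%C * 'i%C = -1 :> C by rewrite -expr2 sqr_i.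
(* Along a vertical side the derivative of U is i f, so the primitive of f is -i U; the factor i in
   front of the vertical integrals then makes the corner values cancel. *)
have prim_v x (H : forall t, c <= t <= d -> in_bdry a b c d (pt x t)) :
    is_prim c d (fun y => f (pt x y)) (fun y => - 'i%C * U (pt x y)).
  move=> t /H/HU/cderiv_v/(rderivZ (- 'i%C)); congr rderiv.
  by rewrite mulrA mulNr i2 opprK mul1r.
rewrite (JintE cd (prim_v a bdryL)) (JintE cd (prim_v b bdryR)).
transitivity (U (pt b c) - U (pt a c) - (U (pt b d) - U (pt a d)) -
  ('i%C * 'i%C) * (U (pt b d) - U (pt b c) - (U (pt a d) - U (pt a c)))); first by ring.
rewrite i2; ring.
Qed.

Lemma oint_chasles_h m f : a <= m <= b -> (forall z, in_rect a b c d z -> ccont f z) ->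
  oint a b c d f = oint a m c d f + oint m b c d f.
Proof.
move=> mab cf; have cb : bdry_cont f by move=> z /bdry_rect/cf.
rewrite /oint (Jint_chasles ab mab (ctD cb)) (Jint_chasles ab mab (ctU cb)).
ring.
Qed.

Lemma oint_chasles_v m f : c <= m <= d -> (forall z, in_rect a b c d z -> ccont f z) ->
  oint a b c d f = oint a b c m f + oint a b m d f.
Proof.
move=> mcd cf; have cb : bdry_cont f by move=> z /bdry_rect/cf.
rewrite /oint (Jint_chasles cd mcd (ctL cb)) (Jint_chasles cd mcd (ctR cb)).
ring.
Qed.

End Rectangle.

Lemma nested_intervals (x l : nat -> R) : (forall n, 0 <= l n) ->
  (forall n, x n <= x n.+1) -> (forall n, x n.+1 + l n.+1 <= x n + l n) ->
  exists z : R, forall n, x n <= z <= x n + l n.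
Proof.
move=> l0 xS lS.
have xm n (m : nat) : (n <= m)%N -> x n <= x m.
  elim: m => [|m IH]; first by rewrite leqn0 => /eqP->.
  by rewrite leq_eqVlt => /predU1P[->//|/IH/le_trans]; apply.
have lm n (m : nat) : (n <= m)%N -> x m + l m <= x n + l n.
  elim: m => [|m IH]; first by rewrite leqn0 => /eqP->.
  by rewrite leq_eqVlt => /predU1P[->//|/IH]; apply: le_trans.
have xl n (m : nat) : x n <= x m + l m.
  have [nm|mn] := leqP n m; first by have := xm _ _ nm; have := l0 m; lra.
  by have := lm _ _ (ltnW mn); have := l0 n; lra.
have ub (m : nat) : ubound (range x) (x m + l m) by move=> _ [n _ <-].
exists (sup (range x)) => n; apply/andP; split.
- by apply: ub_le_sup; [exists (x 0%N + l 0%N)|exists n].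
- by apply: ge_sup => //; exists (x 0%N), 0%N.
Qed.

Lemma small_geom (x e : R) : 0 <= x -> 0 < e -> exists n : nat, x / 2 ^+ n < e.
Proof.
move=> x0 e0; exists (Num.bound (x / e)).
have := archi_boundP (divr_ge0 x0 (ltW e0)); set n := Num.bound _ => Hn.
rewrite ltr_pdivrMr ?exprn_gt0// mulrC -ltr_pdivrMr//; apply: lt_le_trans Hn _.
by rewrite -natrX ler_nat ltnW // ltn_expl.
Qed.

(** Contrapositive of the pigeonhole step in Goursat's bisection: integrals along inner edges
    cancel, so four small quarters make a small whole. Sides are written as sums to avoid
    halving. *)
Lemma oint_quarters f x y l k e : 0 <= l -> 0 <= k ->
  (forall z, in_rect x (x + (l + l)) y (y + (k + k)) z -> ccont f z) ->
  (forall x' y', (x' = x \/ x' = x + l) -> (y' = y \/ y' = y + k) ->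
    cabs (oint x' (x' + l) y' (y' + k) f) < e) ->
  cabs (oint x (x + (l + l)) y (y + (k + k)) f) < e + e + (e + e).
Proof.
move=> l0 k0 cf small.
have ch a' b' : x <= a' -> b' <= x + (l + l) ->
    forall z, in_rect a' b' y (y + (k + k)) z -> ccont f z.
  by move=> ? ? z zr; apply: cf; apply: in_rect_sub zr.
rewrite (@oint_chasles_h x (x + (l + l)) y (y + (k + k)) _ _ (x + l)) //; try lra.
rewrite (@oint_chasles_v x (x + l) y (y + (k + k)) _ _ (y + k)); try lra; last by apply: ch; lra.
rewrite (@oint_chasles_v (x + l) (x + (l + l)) y (y + (k + k)) _ _ (y + k)); try lra; last by apply: ch; lra.
have s1 := small x y (or_introl erefl) (or_introl erefl).
have s2 := small x (y + k) (or_introl erefl) (or_intror erefl).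
have s3 := small (x + l) y (or_intror erefl) (or_introl erefl).
have s4 := small (x + l) (y + k) (or_intror erefl) (or_intror erefl).
rewrite -?(addrA x l l) -?(addrA y k k) in s1 s2 s3 s4.
apply: le_lt_trans (cabsD _ _) _; apply: le_lt_trans (lerD (cabsD _ _) (cabsD _ _)) _.
by rewrite !ltrD.
Qed.

Lemma goursat a b c d f : a <= b -> c <= d ->
  (forall z, in_rect a b c d z -> exists k, cderiv f z k) -> oint a b c d f = 0.
Proof.
move=> ab cd df.
have cf z : in_rect a b c d z -> ccont f z by move=> /df [k /cderiv_cont].
have csub a' b' c' d' : a <= a' -> b' <= b -> c <= c' -> d' <= d ->
    forall z, in_rect a' b' c' d' z -> ccont f z.
  by move=> ? ? ? ? z zr; apply: cf; apply: in_rect_sub zr.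
apply/eqP; rewrite -cabs_eq0 eq_le cabs_ge0 andbT leNgt; apply/negP.
set E := cabs _ => E0.
pose L n : R := (b - a) / 2 ^+ n; pose K n : R := (d - c) / 2 ^+ n.
have pow0 n : 0 < 2 ^+ n :> R by rewrite exprn_gt0.
have L0 n : 0 <= L n by rewrite divr_ge0 ?subr_ge0// ltW.
have K0 n : 0 <= K n by rewrite divr_ge0 ?subr_ge0// ltW.
have LS n : L n = L n.+1 + L n.+1 by rewrite /L exprS invfM; field; rewrite gt_eqF.
have KS n : K n = K n.+1 + K n.+1 by rewrite /K exprS invfM; field; rewrite gt_eqF.
(* Lower left corners of the n-th generation rectangles that keep at least the share E / 4^n of the
   integral. *)
pose bad n (p : R * R) := [/\ a <= p.1, p.1 + L n <= b, c <= p.2, p.2 + K n <= d &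
  E / 4 ^+ n <= cabs (oint p.1 (p.1 + L n) p.2 (p.2 + K n) f)].
have step (np : nat * (R * R)) : exists q : R * R, bad np.1 np.2 ->
    [/\ bad np.1.+1 q, np.2.1 <= q.1, q.1 + L np.1.+1 <= np.2.1 + L np.1,
      np.2.2 <= q.2 & q.2 + K np.1.+1 <= np.2.2 + K np.1].
  case: np => n [x y] /=; apply: contrapT => /forallNP H.
  have : bad n (x, y) by have /not_implyP[] := H (x, y).
  move=> [/= ax xb cy yd]; apply/negP; rewrite -ltNge.
  pose l := L n.+1; pose k := K n.+1; have l0 : 0 <= l := L0 n.+1.
  have k0 : 0 <= k := K0 n.+1.
  have E4 : E / 4 ^+ n = E / 4 ^+ n.+1 + E / 4 ^+ n.+1 + (E / 4 ^+ n.+1 + E / 4 ^+ n.+1).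
    by rewrite exprS; field; rewrite expf_neq0 ?pnatr_eq0.
  rewrite E4; rewrite (LS n) (KS n) -/l -/k in xb yd *.
  apply: oint_quarters => //; first exact: csub.
  move=> x' y' hx hy; rewrite ltNge; apply/negP => hE; apply: (H (x', y')) => _.
  rewrite /= (LS n) (KS n) -/l -/k.
  have [x1 x2] : x <= x' /\ x' + l <= x + (l + l) by clear - l0 hx; case: hx => ->; split; lra.
  have [y1 y2] : y <= y' /\ y' + k <= y + (k + k) by clear - k0 hy; case: hy => ->; split; lra.
  split=> //; split=> //=;
    [exact: le_trans ax x1|exact: le_trans x2 xb|exact: le_trans cy y1|exact: le_trans y2 yd].
have [F HF] := choice step.
pose fix S (n : nat) : R * R := if n is n'.+1 then F (n', S n') else (a, c).
have badS n : bad n (S n).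
  elim: n => [|n IH]; last by have [] := HF (n, S n) IH.
  by rewrite /bad /L /K /= !expr0 !divr1 !(addrC a) !(addrC c) !subrK !lexx.
have SS n := HF (n, S n) (badS n).
have [||x0 Hx] := @nested_intervals (fun n => (S n).1) L L0.
- by move=> n; have [] := SS n.
- by move=> n; have [] := SS n.
have [||y0 Hy] := @nested_intervals (fun n => (S n).2) K K0.
- by move=> n; have [] := SS n.
- by move=> n; have [] := SS n.
pose z0 := pt x0 y0.
have [|k Hk] := df z0.
  have := Hx 0%N; have := Hy 0%N; rewrite /L /K /in_rect /= expr0 !divr1 => /andP[? ?] /andP[? ?].
  by apply/andP; split; apply/andP; split; lra.
pose P := b - a + (d - c); have P0 : 0 <= P by rewrite /P; lra.
(* The final estimate for the n-th rectangle is 2 e P^2 / 4^n, and this choice of e makes it less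
   than E / 4^n; the summand 1 covers the degenerate case P = 0. *)
have e0 : 0 < E / (4 * (P ^+ 2 + 1)) by rewrite divr_gt0// mulr_gt0// ltr_wpDl ?sqr_ge0.
have [r r0 Hr] := Hk _ e0; set e := E / _ in Hr e0.
have [n Hn] := small_geom P0 r0.
have [ax xb cy yd] := badS n; apply/negP; rewrite -ltNge.
move: (S n) (Hx n) (Hy n) ax xb cy yd => [x y] /= hx hy ax xb cy yd.
have xL : x <= x + L n by rewrite lerDl.
have yK : y <= y + K n by rewrite lerDl.
(* The affine part of f at the limit point has a primitive and integrates to 0, so only the
   remainder of the differentiability estimate contributes. *)
pose aff z : C := f z0 + k * (z - z0).
pose rem z : C := f z - aff z.
have daff z : cderiv aff z k.
  apply: cderiv_eq (cderivD (cderiv_cst (f z0) z) (cderivZ k (cderivB (cderiv_id z) (cderiv_cst z0 z)))) _.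
  ring.
have drem z : in_rect x (x + L n) y (y + K n) z -> ccont rem z.
  move=> zr; have [|k' Hk'] := df z; first exact: in_rect_sub zr.
  exact: cderiv_cont (cderivB Hk' (daff z)).
have -> : f = (fun z => rem z + aff z) by apply/funext => z; rewrite /rem subrK.
rewrite ointD//; first last.
- by move=> z _; apply: cderiv_cont (daff z).
- by move=> z /bdry_rect; apply: drem.
rewrite (@oint_deriv x (x + L n) y (y + K n) xL yK
  (fun z => f z0 * z + (k / 2) * (z - z0) ^+ 2) aff) ?addr0; last first.
  move=> z _; apply: cderiv_eq (cderivD (cderivZ (f z0) (cderiv_id z)) (cderivZ (k / 2)
    (cderivX 2 (cderivB (cderiv_id z) (cderiv_cst z0 z))))) _.
  by rewrite /aff /= expr1; field.
have LK : L n + K n = P / 2 ^+ n by rewrite /L /K /P -mulrDl.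
apply: le_lt_trans (@oint_bound _ _ _ _ xL yK rem (e * (P / 2 ^+ n)) _ _) _.
- by move=> z /bdry_rect; apply: drem.
- case=> u v /bdry_rect; rewrite /in_rect /= => /andP[/andP[u1 u2] /andP[v1 v2]].
  have lt : cabs ((u +i* v)%C - z0) <= P / 2 ^+ n.
    apply: le_trans (cabs_le_ReIm _) _; rewrite -LK /=.
    apply: lerD; rewrite ler_norml.
      by clear - u1 u2 hx; apply/andP; split; lra.
    by clear - v1 v2 hy; apply/andP; split; lra.
  have := Hr _ (le_lt_trans lt Hn); rewrite /rem /aff opprD addrA => /le_trans; apply.
  by rewrite ler_wpM2l// ltW.
rewrite [x + _]addrC addrK [y + _]addrC addrK LK.
have -> : 2 * (e * (P / 2 ^+ n)) * (P / 2 ^+ n) = 2 * e * P ^+ 2 / 4 ^+ n.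
  have -> : 4 = 2 * 2 :> R by ring.
  by rewrite exprMn; field; rewrite gt_eqF.
rewrite ltr_pM2r ?invr_gt0 ?exprn_gt0//.
have -> : E = e * (4 * (P ^+ 2 + 1)).
  by rewrite /e divfK// gt_eqF// mulr_gt0// ltr_wpDl ?sqr_ge0.
have := sqr_ge0 P; move: (P ^+ 2) => Q; nra.
Qed.

(** Strips to the left, to the right, below and above the small square are cut off in turn; none of
    them contains the centre, so their integrals vanish. *)
Lemma oint_shrink a b c d u v h f : 0 < h ->
  a < u - h -> u + h < b -> c < v - h -> v + h < d ->
  (forall z, in_rect a b c d z -> ccont f z) ->
  (forall a' b' c' d', a <= a' -> a' <= b' -> b' <= b -> c <= c' -> c' <= d' -> d' <= d ->
    ~~ in_rect a' b' c' d' (pt u v) -> oint a' b' c' d' f = 0) ->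
  oint a b c d f = oint (u - h) (u + h) (v - h) (v + h) f.
Proof.
move=> h0 ha hb hc hd cf zero.
have csub a' b' c' d' : a <= a' -> b' <= b -> c <= c' -> d' <= d ->
    forall z, in_rect a' b' c' d' z -> ccont f z.
  by move=> ? ? ? ? z zr; apply: cf; apply: in_rect_sub zr.
have -> : oint a b c d f = oint a (u - h) c d f + oint (u - h) b c d f.
  by apply: oint_chasles_h => //; lra.
have -> : oint (u - h) b c d f = oint (u - h) (u + h) c d f + oint (u + h) b c d f.
  by apply: oint_chasles_h; try lra; apply: csub; lra.
have -> : oint (u - h) (u + h) c d f =
    oint (u - h) (u + h) c (v - h) f + oint (u - h) (u + h) (v - h) d f.
  by apply: oint_chasles_v; try lra; apply: csub; lra.
have -> : oint (u - h) (u + h) (v - h) d f =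
    oint (u - h) (u + h) (v - h) (v + h) f + oint (u - h) (u + h) (v + h) d f.
  by apply: oint_chasles_v; try lra; apply: csub; lra.
have -> : oint a (u - h) c d f = 0.
  by apply: zero; try lra; rewrite /in_rect /=; apply/negP => /andP[/andP[]]; lra.
have -> : oint (u + h) b c d f = 0.
  by apply: zero; try lra; rewrite /in_rect /=; apply/negP => /andP[/andP[]]; lra.
have -> : oint (u - h) (u + h) c (v - h) f = 0.
  by apply: zero; try lra; rewrite /in_rect /=; apply/negP => /andP[_ /andP[]]; lra.
have -> : oint (u - h) (u + h) (v + h) d f = 0.
  by apply: zero; try lra; rewrite /in_rect /=; apply/negP => /andP[_ /andP[]]; lra.
by rewrite !add0r !addr0.
Qed.

(* Goursat's theorem shrinks the contour to an arbitrarily small square around [w]. *)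
Lemma goursat_punctured a b c d w f :
  a < complex.Re w < b -> c < complex.Im w < d ->
  (forall z, in_rect a b c d z -> ccont f z) ->
  (forall z, in_rect a b c d z -> z != w -> exists k, cderiv f z k) ->
  oint a b c d f = 0.
Proof.
case: w => u v /= /andP[au ub] /andP[cv vd] cf df.
set w : C := (u +i* v)%C in df *.
have [||r r0 Hr] := cf w _ 1 _ => //; first by rewrite /in_rect /= !ltW.
apply/eqP; rewrite -cabs_eq0 eq_le cabs_ge0 andbT; apply/ler_addgt0Pl => e; rewrite addr0 => e0.

(* M bounds f near w by continuity; a square of half-side h has integral at most 2 M (2h + 2h) = 8 M
   h, which explains the condition on h below. *)
pose M := cabs (f w) + 1; have M0 : 0 < M by have := cabs_ge0 (f w); rewrite /M; lra.
have [h [h0 [hr [he [ha [hb [hc hd]]]]]]] : exists h : R, 0 < h /\ h < r / 2 /\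
    8 * M * h <= e /\ h < u - a /\ h < b - u /\ h < v - c /\ h < d - v.
  have [k k0] : exists2 k : R, 0 < k & k <= Num.min (Num.min (r / 2) (e / (8 * M)))
      (Num.min (Num.min (u - a) (b - u)) (Num.min (v - c) (d - v))).
    eexists; last exact: lexx.
    by rewrite !lt_min !subr_gt0 au ub cv vd !divr_gt0 ?mulr_gt0.
  rewrite !le_min => /andP[/andP[h1 h2] /andP[/andP[h3 h4] /andP[h5 h6]]].
  rewrite ler_pdivlMr ?mulr_gt0// in h2; clearbody M; exists (k / 2).
  have Mk : 0 < M * k by rewrite mulr_gt0.
  have E : k * (8 * M) = 8 * (M * k) by ring.
  have -> : 8 * M * (k / 2) = 4 * (M * k) by field.
  by rewrite E in h2; do !split; lra.
have csub a' b' c' d' : a <= a' -> b' <= b -> c <= c' -> d' <= d ->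
    forall z, in_rect a' b' c' d' z -> ccont f z.
  by move=> ? ? ? ? z zr; apply: cf; apply: in_rect_sub zr.
have zero a' b' c' d' : a <= a' -> a' <= b' -> b' <= b -> c <= c' -> c' <= d' -> d' <= d ->
    ~~ in_rect a' b' c' d' w -> oint a' b' c' d' f = 0.
  move=> ? ? ? ? ? ? wn; apply: goursat => // z zr; apply: df; first exact: in_rect_sub zr.
  by apply: contra wn => /eqP <-.
have -> : oint a b c d f = oint (u - h) (u + h) (v - h) (v + h) f.
  by apply: oint_shrink => //; lra.
apply: le_trans (@oint_bound _ _ _ _ _ _ f M _ _) _; try lra.
- by move=> z /bdry_rect; apply: csub; lra.
- case=> x y /bdry_rect; rewrite /in_rect /= => /andP[/andP[? ?] /andP[? ?]].
  have /Hr : cabs ((x +i* y)%C - w) < r.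
    apply: le_lt_trans (cabs_le_ReIm _) _ => /=.
    have : `|x - u| <= h by rewrite ler_norml; lra.
    have : `|y - v| <= h by rewrite ler_norml; lra.
    lra.
  by have := cabsD (f (x +i* y)%C - f w) (f w); rewrite subrK /M; lra.
Qed.

End ContourIntegrals.

(** * Power series expansions *)

Section CauchyExpansion.
Context {R : realType}.
Local Notation C := (Cplx R).
Implicit Types (a b c d x y s t M e : R) (z w h : C) (f g u : C -> C).

Lemma eq_Jint a b (u v : R -> C) : (forall t, a <= t <= b -> u t = v t) ->
  Jint a b u = Jint a b v.
Proof.
move=> E; rewrite /Jint.
suff -> : [set U | is_prim a b u U] = [set U | is_prim a b v U] by [].
by apply/seteqP; split => U HU t tab; [rewrite -E|rewrite E] => //; apply: HU.
Qed.

Lemma eq_oint a b c d f g : a <= b -> c <= d ->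
  (forall z, in_bdry a b c d z -> f z = g z) -> oint a b c d f = oint a b c d g.
Proof.
move=> ab cd E; rewrite /oint; congr (_ - _ + _ * (_ - _)); apply: eq_Jint => t tab;
  by apply: E; rewrite /in_bdry /in_rect /= tab ?lexx ?ab ?cd ?eqxx ?orbT.
Qed.

Lemma rderiv_real (g : R -> R) t (k : R) : is_derive (t : R) (1 : R) g k ->
  rderiv (fun s => (g s)%:C : C) t (k%:C).
Proof.
move=> /is_derive_eps H e /H [r r0 Hr]; exists r => // s' /Hr.
by rewrite -!rmorphB -rmorphM -rmorphB cabs_real [k * _]mulrC.
Qed.

(** Provides the primitives for the integral of 1 / (w - z): opposite sides of a square combine to
    multiples of s / (t^2 + s^2). *)
Lemma is_derive_atan_affine s y t : 0 < s ->
  is_derive (t : R) (1 : R) (fun x => atan ((x - y) / s)) (s / ((t - y) ^+ 2 + s ^+ 2)).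
Proof.
move=> s0.
have H1 : is_derive (t : R) (1 : R) (fun x : R => (x - y) / s) (s^-1).
  apply/is_derive_eps => e e0; exists 1 => // x _.
  have -> : (x - y) / s - (t - y) / s - s^-1 * (x - t) = 0 by field; rewrite gt_eqF.
  by rewrite normr0 mulr_ge0 // ltW.
have := @is_derive1_comp R atan (fun x => (x - y) / s) t _ _ (is_derive1_atan ((t - y) / s)) H1.
congr is_derive; rewrite /GRing.scale /=; field.
have D0 : (t - y) ^+ 2 + s ^+ 2 != 0 by rewrite gt_eqF// ltr_wpDl ?sqr_ge0// exprn_gt0.
by rewrite D0 gt_eqF.
Qed.

Lemma cderiv_subc z w : cderiv (fun x : C => x - w) z 1.
Proof. by apply: cderiv_eq (cderivB (cderiv_id z) (cderiv_cst w z)) _; rewrite subr0. Qed.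

Lemma ccont_inv z w : z - w != 0 -> ccont (fun x : C => (x - w)^-1) z.
Proof.
move=> zw; have H := (@cderivV _ (fun x : C => x - w) _ _ zw (cderiv_subc z w)). exact: cderiv_cont H.
Qed.

Lemma cderiv_inv_pow z w n : z - w != 0 ->
  cderiv (fun x : C => ((x - w) ^+ n)^-1) z
    (- ((z - w) ^+ n) ^- 2 * (n%:R * (z - w) ^+ n.-1 * 1)).
Proof.
move=> zw; have wn : (z - w) ^+ n != 0 by rewrite expf_neq0.
have H := cderivX n (cderiv_subc z w).
exact: (@cderivV _ (fun x : C => (x - w) ^+ n) _ _ wn H).
Qed.

(** The square has half-side s, so its points lie at distance between s and 2 s from z. This is why
    f is later required to be differentiable up to distance 2 s. *)
Definition square_int z s f : C :=
  oint (complex.Re z - s) (complex.Re z + s) (complex.Im z - s) (complex.Im z + s) f.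

Definition on_square z s w :=
  in_bdry (complex.Re z - s) (complex.Re z + s) (complex.Im z - s) (complex.Im z + s) w.

Lemma on_square_ge z s w : on_square z s w -> s <= cabs (w - z).
Proof.
case: z w => x y [x' y'] /andP[_ /= /or4P[]] /eqP E.
- apply: le_trans (cabs_Re _) => /=; rewrite E -normrN; apply: le_trans (ler_norm _); lra.
- apply: le_trans (cabs_Re _) => /=; rewrite E; apply: le_trans (ler_norm _); lra.
- apply: le_trans (cabs_Im _) => /=; rewrite E -normrN; apply: le_trans (ler_norm _); lra.
- apply: le_trans (cabs_Im _) => /=; rewrite E; apply: le_trans (ler_norm _); lra.
Qed.

Lemma in_square_le z s w : in_rect (complex.Re z - s) (complex.Re z + s)
  (complex.Im z - s) (complex.Im z + s) w -> cabs (w - z) <= 2 * s.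
Proof.
case: z w => x y [x' y'] /andP[/= /andP[? ?] /andP[? ?]].
apply: le_trans (cabs_le_ReIm _) _ => /=.
have : `|x' - x| <= s by rewrite ler_norml; lra.
have : `|y' - y| <= s by rewrite ler_norml; lra.
lra.
Qed.

Lemma on_square_le z s w : on_square z s w -> cabs (w - z) <= 2 * s.
Proof. by move=> /bdry_rect; apply: in_square_le. Qed.

(** Direct computation: the horizontal sides together give the integral of 2 i s / (t^2 + s^2), the
    vertical ones that of 2 s / (t^2 + s^2). On [-s, s] the arctangent increases by pi / 2, so the
    two pairs contribute pi i each, once the vertical factor i is included. *)
Lemma square_int_inv z s : 0 < s ->
  square_int z s (fun w => (w - z)^-1) = (2 * pi)%:C * 'i%C.
Proof.
case: z => x y s0; rewrite /square_int /=.
set z : C := (x +i* y)%C.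
have xs : x - s <= x + s by lra.
have ys : y - s <= y + s by lra.
have ci w : on_square z s w -> ccont (fun w : C => (w - z)^-1) w.
  move=> /on_square_ge ws; have wz : w - z != 0 by rewrite -cabs_gt0; lra.
  exact: ccont_inv.
have atR (r : R) : atan ((r + s - r) / s) = pi / 4.
  by rewrite addrAC subrr add0r divff ?gt_eqF// atan1.
have atL (r : R) : atan ((r - s - r) / s) = - (pi / 4).
  by rewrite addrAC subrr add0r mulNr divff ?gt_eqF// atanN atan1.
have e1 (r : R) : r - s - r = - s by ring.
have e2 (r : R) : r + s - r = s by ring.
have D0 (r : R) : r ^+ 2 + s ^+ 2 != 0 by rewrite gt_eqF// ltr_wpDl ?sqr_ge0// exprn_gt0.
have D0' (r : R) : s ^+ 2 + r ^+ 2 != 0 by rewrite addrC.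
have ch c' : y - s <= c' <= y + s -> (c' == y - s) || (c' == y + s) ->
    forall t, x - s <= t <= x + s -> rcont (fun t => (pt t c' - z)^-1) t.
  move=> hc' E t tab; apply: (@ccont_h _ (fun w => (w - z)^-1)); apply: ci.
  by rewrite /on_square /in_bdry /in_rect /= tab hc' E !orbT.
have cv c' : x - s <= c' <= x + s -> (c' == x - s) || (c' == x + s) ->
    forall t, y - s <= t <= y + s -> rcont (fun t => (pt c' t - z)^-1) t.
  move=> hc' E t tab; apply: (@ccont_v _ (fun w => (w - z)^-1)); apply: ci.
  by rewrite /on_square /in_bdry /in_rect /= tab hc' orbA E.
have cN (u : R -> C) t : rcont u t -> rcont (fun t => -1 * u t) t.
  move=> H e /H [d d0 Hd]; exists d => // s' /Hd.
  by rewrite -mulrBr cabsM cabsN cabs1 mul1r.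
have hor : Jint (x - s) (x + s) (fun t => (pt t (y - s) - z)^-1) -
    Jint (x - s) (x + s) (fun t => (pt t (y + s) - z)^-1) = pi%:C * 'i%C.
  have cl1 : forall t, x - s <= t <= x + s -> rcont (fun t => (pt t (y - s) - z)^-1) t.
    by apply: ch; rewrite ?eqxx// lexx.
  have cl2 : forall t, x - s <= t <= x + s -> rcont (fun t => (pt t (y + s) - z)^-1) t.
    by apply: ch; rewrite ?eqxx ?orbT// lexx andbT.
  rewrite -[- Jint _ _ _]mulN1r -JintZ// -JintD//; last by move=> t tab; apply: cN; apply: cl2.
  rewrite (@JintE _ _ _ _ (fun t => (2%:C * 'i%C) * (atan ((t - x) / s))%:C))//; last first.
    move=> t _; have := rderivZ (2%:C * 'i%C) (rderiv_real (is_derive_atan_affine x t s0)).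
    congr rderiv; apply/eqP; rewrite eq_complex /=; rewrite !e1 !e2 sqrrN.
    move: (D0 (t - x)); set D := (_ + _) => D00.
    by apply/andP; split; apply/eqP; field.
  rewrite atR atL -mulrBr -rmorphB mulrAC -rmorphM.
  by have -> : 2 * (pi / 4 - - (pi / 4)) = pi :> R by field.
have ver : Jint (y - s) (y + s) (fun t => (pt (x + s) t - z)^-1) -
    Jint (y - s) (y + s) (fun t => (pt (x - s) t - z)^-1) = pi%:C.
  have cl1 : forall t, y - s <= t <= y + s -> rcont (fun t => (pt (x - s) t - z)^-1) t.
    by apply: cv; rewrite ?eqxx// lexx.
  have cl2 : forall t, y - s <= t <= y + s -> rcont (fun t => (pt (x + s) t - z)^-1) t.
    by apply: cv; rewrite ?eqxx ?orbT// lexx andbT.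
  rewrite -[- Jint _ _ _]mulN1r -JintZ// -JintD//; last by move=> t tab; apply: cN; apply: cl1.
  rewrite (@JintE _ _ _ _ (fun t => 2%:C * (atan ((t - y) / s))%:C))//; last first.
    move=> t _; have := rderivZ 2%:C (rderiv_real (is_derive_atan_affine y t s0)).
    congr rderiv; apply/eqP; rewrite eq_complex /=; rewrite !e1 !e2 sqrrN.
    move: (D0' (t - y)); rewrite [_ + s ^+ 2]addrC; set D := (_ + _) => D00.
    by apply/andP; split; apply/eqP; field.
  rewrite atR atL -mulrBr -rmorphB -rmorphM.
  by have -> : 2 * (pi / 4 - - (pi / 4)) = pi :> R by field.
rewrite /oint hor ver rmorphM rmorph_nat; ring.
Qed.

(** Finite geometric expansion of 1 / (w - z - h) in powers of h / (w - z), with exact remainder.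
    The remainder integrand without h^N is at most (M / s^N) (2 / s), since the square stays at
    distance s / 2 from z + h; the factor 8 s from [oint_bound] makes this 16 M / s^N. *)
Lemma kernel_expansion z s h u M N : 0 < s -> 0 <= M -> cabs h <= s / 2 ->
  (forall w, on_square z s w -> ccont u w) ->
  (forall w, on_square z s w -> cabs (u w) <= M) ->
  cabs (square_int z s (fun w => u w * (w - (z + h))^-1) -
    \sum_(n < N) h ^+ n * square_int z s (fun w => u w * ((w - z) ^+ n.+1)^-1))
  <= 16 * M * (cabs h / s) ^+ N.
Proof.
move=> s0 M0 hs cu uM.
have xs : complex.Re z - s <= complex.Re z + s by lra.
have ys : complex.Im z - s <= complex.Im z + s by lra.
have n1 w : on_square z s w -> w - z != 0.
  by move=> /on_square_ge ?; rewrite -cabs_gt0; lra.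
have lh w : on_square z s w -> s / 2 <= cabs (w - (z + h)).
  move=> /on_square_ge ?; rewrite opprD addrA.
  by have := cabs_sub_ge (w - z) h; lra.
have n2 w : on_square z s w -> w - (z + h) != 0.
  by move=> /lh ?; rewrite -cabs_gt0; lra.
have c1 n w : on_square z s w -> ccont (fun w : C => ((w - z) ^+ n)^-1) w.
  by move=> /n1 wz; apply: cderiv_cont (cderiv_inv_pow n wz).
have c2 w : on_square z s w -> ccont (fun w : C => (w - (z + h))^-1) w.
  by move=> /n2; apply: ccont_inv.
have c3 n w : on_square z s w -> ccont (fun w => u w * ((w - z) ^+ n)^-1) w.
  by move=> ws; apply: ccontM; [apply: cu|apply: c1].
have c4 n w : on_square z s w -> ccont (fun w => u w * ((w - z) ^+ n)^-1 * (w - (z + h))^-1) w.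
  by move=> ws; apply: ccontM; [apply: c3|apply: c2].
have -> : square_int z s (fun w => u w * (w - (z + h))^-1) =
  \sum_(n < N) h ^+ n * square_int z s (fun w => u w * ((w - z) ^+ n.+1)^-1) +
  h ^+ N * square_int z s (fun w => u w * ((w - z) ^+ N)^-1 * (w - (z + h))^-1).
  elim: N => [|N IH].
    rewrite big_ord0 add0r expr0 mul1r; congr square_int; apply/funext => w.
    by rewrite expr0 invr1 mulr1.
  rewrite IH big_ord_recr /= -addrA; congr (_ + _).
  rewrite exprSr -mulrA -mulrDr; congr (_ * _).
  rewrite /square_int -ointZ//; last by move=> w; apply: c4.
  rewrite -ointD//; last 2 first.
  - by move=> w; apply: c3.
  - by move=> w ws; apply: ccontM; [exact: cderiv_cont (cderiv_cst _ _)|exact: c4].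
  apply: eq_oint => // w ws; rewrite exprS; field.
  by rewrite expf_neq0 ?n1//= n2.
rewrite addrC addKr cabsM cabsX expr_div_n.
have sN : 0 < s ^+ N by rewrite exprn_gt0.
have := @oint_bound R _ _ _ _ xs ys (fun w => u w * ((w - z) ^+ N)^-1 * (w - (z + h))^-1)
  (M * (s ^+ N)^-1 * (s / 2)^-1).
move=> /(_ (c4 N)) H.
have : cabs (square_int z s (fun w => u w * ((w - z) ^+ N)^-1 * (w - (z + h))^-1)) <=
    16 * M / s ^+ N.
  apply: le_trans (H _) _.
    move=> w ws; rewrite !cabsM !cabsV cabsX.
    have g1 := on_square_ge ws; have g2 := lh _ ws.
    apply: ler_pM; rewrite ?mulr_ge0 ?invr_ge0 ?exprn_ge0 ?cabs_ge0//.
      apply: ler_pM; rewrite ?invr_ge0 ?exprn_ge0 ?cabs_ge0 ?uM//.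
      by rewrite lef_pV2 ?posrE ?exprn_gt0//; [apply: lerXn2r; rewrite ?nnegrE ?cabs_ge0// ltW|lra].
    by rewrite lef_pV2 ?posrE //; lra.
  by rewrite le_eqVlt; apply/orP; left; apply/eqP; field; rewrite !gt_eqF.
move=> /(ler_wpM2l (exprn_ge0 N (cabs_ge0 h))) /le_trans; apply.
by rewrite le_eqVlt; apply/orP; left; apply/eqP; field; rewrite !gt_eqF.
Qed.

Lemma square_int_inv_pow z s n : 0 < s -> square_int z s (fun w => ((w - z) ^+ n.+2)^-1) = 0.
Proof.
move=> s0; rewrite /square_int.
rewrite (@oint_deriv _ _ _ _ _ _ _ (fun w => - (n.+1%:R)^-1 * ((w - z) ^+ n.+1)^-1))//; try lra.
move=> w /on_square_ge ws; have wz : w - z != 0 by rewrite -cabs_gt0; lra.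
apply: cderiv_eq (cderivZ _ (cderiv_inv_pow n.+1 wz)) _.
rewrite /= !exprS; field.
by rewrite wz !expf_neq0 //= natr1 pnatr_eq0.
Qed.

(** Expand the kernel with u = 1: powers beyond the first have primitives and integrate to 0, so the
    difference to the centred integral is at most 16 / 2^N for every N. *)
Lemma square_int_inv_shift z s h : 0 < s -> cabs h <= s / 2 ->
  square_int z s (fun w => (w - (z + h))^-1) = (2 * pi)%:C * 'i%C.
Proof.
move=> s0 hs; apply/eqP; rewrite -subr_eq0 -cabs_eq0 eq_le cabs_ge0 andbT leNgt; apply/negP => D0.
have [N HN] := @small_geom R 16 _ (ler0n _ _) D0.
have := @kernel_expansion z s h (fun=> 1) 1 N.+1 s0 ler01 hs _ _.
have -> : (fun w => 1 * (w - (z + h))^-1) = (fun w => (w - (z + h))^-1) by apply/funext => w; rewrite mul1r.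
rewrite big_ord_recl big1 => [|n _]; last first.
  rewrite (_ : (fun w => _) = (fun w => ((w - z) ^+ n.+2)^-1)); last by apply/funext => w; rewrite mul1r.
  by rewrite square_int_inv_pow ?mulr0.
rewrite expr0 mul1r addr0.
rewrite (_ : (fun w => 1 * ((w - z) ^+ 1)^-1) = (fun w => (w - z)^-1)); last by apply/funext => w; rewrite mul1r expr1.
rewrite square_int_inv// mulr1 => /(_ _ _) H.
have := lt_le_trans HN (H _ _); rewrite ltNge => /(_ _ _)/negP; apply.
- by move=> w _; apply: cderiv_cont (cderiv_cst _ _).
- by move=> w _; rewrite cabs1.
rewrite ler_pM2l//; have hh : cabs h / s <= 2^-1 by rewrite ler_pdivrMr// mulrC.
have h0 : 0 <= cabs h / s by rewrite divr_ge0 ?cabs_ge0 ?ltW.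
apply: le_trans (_ : 2^-1 ^+ N.+1 <= _); first by apply: lerXn2r; rewrite ?nnegrE.
by rewrite exprVn lef_pV2 ?posrE ?exprn_gt0// ler_eXn2l// ltr1n.
Qed.

End CauchyExpansion.

(** * Cauchy's formula and Taylor estimates *)

Section PowerExpansion.
Context {R : realType}.
Local Notation C := (Cplx R).
Implicit Types (s t M e : R) (z w h : C) (f g u : C -> C) (a b : nat -> C).

(** One constant M serves all N and h. For N = 0 the estimate bounds f by M, for N = 1 it is a
    Lipschitz estimate at z, for N = 2 it gives the derivative. Keeping h within s / 2 makes the
    remainder at most M / 2^N, so the coefficients determine f on that disc. *)
Definition expands f z s M a := forall N h, cabs h <= s / 2 ->
  cabs (f (z + h) - \sum_(n < N) a n * h ^+ n) <= M * (cabs h / s) ^+ N.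

Definition diff_quot f z (k : C) w := if w == z then k else (f w - f z) / (w - z).

Lemma diff_quot_cont f z k : cderiv f z k -> ccont (diff_quot f z k) z.
Proof.
move=> H e e0; have e20 : 0 < e / 2 by lra.
have [r r0 Hr] := H _ e20; exists r => // w wr; rewrite /diff_quot eqxx.
case: eqVneq => [_|wz]; first by rewrite subrr cabs0.
have wz0 : w - z != 0 by rewrite subr_eq0.
have -> : (f w - f z) / (w - z) - k = (f w - f z - k * (w - z)) / (w - z) by field.
rewrite cabsM cabsV ltr_pdivrMr ?cabs_gt0//; apply: le_lt_trans (Hr _ wr) _.
by rewrite ltr_pM2r ?cabs_gt0//; lra.
Qed.

Lemma diff_quot_cderiv f z k w l : w != z -> cderiv f w l ->
  exists k', cderiv (diff_quot f z k) w k'.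
Proof.
move=> wz H; have wz0 : w - z != 0 by rewrite subr_eq0.
have H1 := cderivB H (cderiv_cst (f z) w).
have H2 := @cderivV _ (fun x : C => x - z) _ _ wz0 (cderiv_subc w z).
eexists; apply: eq_cderiv (cderivM H1 H2).
apply/nearCP; exists (cabs (w - z)); first by rewrite cabs_gt0.
move=> x; rewrite /diff_quot; case: eqVneq => [->|//].
by rewrite cabsBC ltxx.
Qed.

(** The difference quotient of f at z + h, completed by the derivative, is continuous there and
    differentiable elsewhere, so [goursat_punctured] kills its integral; what is left is f(z + h)
    times the integral of the kernel. *)
Lemma cauchy_formula f z s h : 0 < s -> cabs h <= s / 2 ->
  (forall w, cabs (w - z) <= 2 * s -> exists k, cderiv f w k) ->
  square_int z s (fun w => f w * (w - (z + h))^-1) = f (z + h) * ((2 * pi)%:C * 'i%C).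
Proof.
move=> s0 hs df.
have xs : complex.Re z - s <= complex.Re z + s by lra.
have ys : complex.Im z - s <= complex.Im z + s by lra.
have [k Hk] : exists k, cderiv f (z + h) k by apply: df; rewrite addrC addKr; lra.
have n2 w : on_square z s w -> w - (z + h) != 0.
  move=> /on_square_ge ?; rewrite -cabs_gt0 opprD addrA.
  by have := cabs_sub_ge (w - z) h; lra.
have c2 w : on_square z s w -> ccont (fun w : C => (w - (z + h))^-1) w.
  by move=> /n2; apply: ccont_inv.
have c3 w : on_square z s w -> ccont (fun w : C => f w * (w - (z + h))^-1) w.
  move=> ws; apply: ccontM; last exact: c2.
  by have [l /cderiv_cont] := df _ (on_square_le ws).
have Q0 : square_int z s (diff_quot f (z + h) k) = 0.
  have hRe := cabs_Re h; have hIm := cabs_Im h.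
  have [h1 h2] : `|complex.Re h| <= s / 2 /\ `|complex.Im h| <= s / 2 by lra.
  move: h1 h2; rewrite !ler_norml => /andP[h1 h2] /andP[h3 h4].
  apply: (@goursat_punctured _ _ _ _ _ (z + h)).
  - by case: z h h1 h2 {h3 h4 hs df xs ys Hk n2 c2 c3 hRe hIm} => x y [x' y'] /= ? ?; lra.
  - by case: z h h3 h4 {h1 h2 hs df xs ys Hk n2 c2 c3 hRe hIm} => x y [x' y'] /= ? ?; lra.
  - move=> w /in_square_le/df [l Hl]; have [->|wz] := eqVneq w (z + h).
      exact: diff_quot_cont.
    by have [l' /cderiv_cont] := diff_quot_cderiv k wz Hl.
  - by move=> w /in_square_le/df [l Hl] wz; apply: diff_quot_cderiv Hl.
rewrite -(@square_int_inv_shift R z s h s0 hs) -[RHS]addr0 -Q0 /square_int.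
rewrite -ointZ// -ointD//; first last.
- move=> w /bdry_rect/in_square_le/df [l Hl]; have [->|wz] := eqVneq w (z + h).
    exact: diff_quot_cont.
  by have [l' /cderiv_cont] := diff_quot_cderiv k wz Hl.
- by move=> w ws; apply: ccontM; [exact: cderiv_cont (cderiv_cst _ _)|exact: c2].
apply: eq_oint => // w ws; have wn := n2 _ ws.
by rewrite /diff_quot -subr_eq0 (negPf wn); ring.
Qed.

Lemma holo_expands f z s M : 0 < s -> 0 <= M ->
  (forall w, cabs (w - z) <= 2 * s -> exists k, cderiv f w k) ->
  (forall w, cabs (w - z) <= 2 * s -> cabs (f w) <= M) ->
  exists a, expands f z s (16 * M) a.
Proof.
move=> s0 M0 df fM; pose c : C := (2 * pi)%:C * 'i%C.
(* Dividing by 2 pi i does not increase moduli, so the constant 16 M is simply kept. *)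
have c1 : 1 <= cabs c.
  rewrite cabsM cabs_i mulr1 cabs_real; apply: le_trans (ler_norm _).
  by have := pi_ge2 R; lra.
have c0 : c != 0 by rewrite -cabs_gt0; lra.
exists (fun n => square_int z s (fun w => f w * ((w - z) ^+ n.+1)^-1) / c) => N h hs.
have := @kernel_expansion R z s h f M N s0 M0 hs.
move=> /(_ _ _) H; have {H} := H _ _.
rewrite (cauchy_formula s0 hs df) -/c.
have -> : f (z + h) * c - \sum_(n < N) h ^+ n * square_int z s (fun w => f w * ((w - z) ^+ n.+1)^-1) =
   c * (f (z + h) - \sum_(n < N) square_int z s (fun w => f w * ((w - z) ^+ n.+1)^-1) / c * h ^+ n).
  rewrite mulrBr [c * f _]mulrC mulr_sumr; congr (_ - _); apply: eq_bigr => n _.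
  by field.
move=> H; apply: le_trans (H _ _).
- by rewrite cabsM ler_peMl ?cabs_ge0.
- by move=> w /on_square_le/df [k /cderiv_cont].
- by move=> w /on_square_le/fM.
Qed.

(** At h = s / 2 the term a_n h^n is the difference of two consecutive remainders, of moduli at most
    M / 2^n and M / 2^(n+1). *)
Lemma expands_coef f z s M a n : 0 < s -> 0 <= M -> expands f z s M a ->
  cabs (a n) <= 2 * M / (s / 2) ^+ n.
Proof.
move=> s0 M0 H; rewrite ler_pdivlMr ?exprn_gt0 ?divr_gt0//.
have ch : cabs ((s / 2)%:C : C) = s / 2 by rewrite cabs_real ger0_norm// divr_ge0// ltW.
have hs : cabs ((s / 2)%:C : C) <= s / 2 by rewrite ch.
have h1 := H n _ hs; have := H n.+1 _ hs; rewrite big_ord_recr /= opprD addrA => h2.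
have := cabsBC (f (z + (s / 2)%:C) - \sum_(i < n) a i * (s / 2)%:C ^+ i - a n * (s / 2)%:C ^+ n)
   (f (z + (s / 2)%:C) - \sum_(i < n) a i * (s / 2)%:C ^+ i).
have := cabsB (f (z + (s / 2)%:C) - \sum_(i < n) a i * (s / 2)%:C ^+ i)
  (f (z + (s / 2)%:C) - \sum_(i < n) a i * (s / 2)%:C ^+ i - a n * (s / 2)%:C ^+ n).
rewrite opprB addrCA subrr addr0 cabsM cabsX ch => h3 _.
have E : s / 2 / s = 2^-1 by field; rewrite gt_eqF.
rewrite ch E in h1 h2.
have p1 (m : nat) : 2^-1 ^+ m <= 1 :> R by rewrite exprn_ile1 ?invr_ge0// invf_le1// ler1n.
have := p1 n; have := p1 n.+1; nra.
Qed.

Lemma expands_0 f z s M a : 0 < s -> expands f z s M a -> a 0%N = f z.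
Proof.
move=> s0 H; have := H 1%N 0; rewrite cabs0 mul0r expr1 mulr0 => /(_ _) H'.
apply/esym/eqP; rewrite -subr_eq0 -cabs_eq0 eq_le cabs_ge0 andbT.
by have := H' _; rewrite addr0 big_ord_recl big_ord0 expr0 mulr1 addr0; apply; lra.
Qed.

Lemma expands_cderiv f z s M a : 0 < s -> 0 <= M -> expands f z s M a ->
  cderiv f z (a 1%N).
Proof.
move=> s0 M0 H e e0; have a0 := expands_0 s0 H.
have K0 : 0 < M + 1 by lra.
exists (Num.min (s / 2) (e * s ^+ 2 / (M + 1))).
  by rewrite lt_min !divr_gt0 ?mulr_gt0 ?exprn_gt0.
move=> w; rewrite lt_min => /andP[/ltW w1 w2].
have zw : z + (w - z) = w by rewrite addrC subrK.
have := H 2 _ w1; rewrite zw !big_ord_recl big_ord0 /= expr0 mulr1 addr0.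
rewrite /bump /= addn0 expr1 a0 opprD addrA => /le_trans; apply.
rewrite expr_div_n mulrA ler_pdivrMr ?exprn_gt0//.
have := cabs_ge0 (w - z); move: w2; rewrite ltr_pdivlMr//.
move: (cabs (w - z)) (s ^+ 2) => x y; nra.
Qed.

Lemma expands_lip f z s M a h : 0 < s -> expands f z s M a -> cabs h <= s / 2 ->
  cabs (f (z + h) - f z) <= M / s * cabs h.
Proof.
move=> s0 H hs; have := H 1%N _ hs.
rewrite big_ord_recl big_ord0 expr0 mulr1 addr0 (expands_0 s0 H) expr1.
by rewrite mulrA mulrAC.
Qed.

(** Cauchy's estimate from an expansion around w with parameter s / 4, whose square stays within s
    of z. The first coefficient is at most 2 (16 M) / (s / 8), hence 256. *)
Lemma derive1_bound f z s M w : 0 < s -> 0 <= M ->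
  (forall w, cabs (w - z) <= s -> exists k, cderiv f w k) ->
  (forall w, cabs (w - z) <= s -> cabs (f w) <= M) ->
  cabs (w - z) <= s / 2 -> cabs (derive1 f w) <= 256 / s * M.
Proof.
move=> s0 M0 df fM ws; have s40 : 0 < s / 4 by lra.
have sub x : cabs (x - w) <= 2 * (s / 4) -> cabs (x - z) <= s.
  by move=> xw; have := cabs_trans x w z; lra.
have [a Ha] := holo_expands s40 M0 (fun x xw => df x (sub x xw)) (fun x xw => fM x (sub x xw)).
have M160 : 0 <= 16 * M by lra.
rewrite (cderiv_derive1 (expands_cderiv s40 M160 Ha)).
apply: le_trans (expands_coef 1 s40 M160 Ha) _.
by rewrite expr1 le_eqVlt; apply/orP; left; apply/eqP; field; rewrite gt_eqF.
Qed.

End PowerExpansion.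

(** * Montel's theorem *)

Section Subsequences.

Definition sincr (phi : nat -> nat) := forall n, (phi n < phi n.+1)%N.

(* Apart from finitely many terms, the values of [psi] are far-out values of [phi]. *)
Definition esub (psi phi : nat -> nat) :=
  forall N, exists N', forall n, (N' <= n)%N -> exists2 n', (N <= n')%N & psi n = phi n'.

Lemma sincr_lt phi m n : sincr phi -> (m < n)%N -> (phi m < phi n)%N.
Proof.
move=> H; elim: n => // n IH; rewrite ltnS leq_eqVlt => /predU1P[->//|/IH /ltn_trans]; apply.
exact: H.
Qed.

Lemma sincr_ge phi n : sincr phi -> (n <= phi n)%N.
Proof. by move=> H; elim: n => // n IH; apply: leq_ltn_trans IH (H n). Qed.

Lemma sincr_comp phi psi : sincr phi -> sincr psi -> sincr (phi \o psi).
Proof. by move=> Hphi Hpsi n; exact: sincr_lt Hphi (Hpsi n). Qed.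

Lemma esub_comp phi psi : sincr psi -> esub (phi \o psi) phi.
Proof.
move=> H N; exists N => n Nn; exists (psi n) => //.
exact: leq_trans Nn (sincr_ge n H).
Qed.

Lemma subseq_choose (Q : nat -> nat -> Prop) :
  (forall k N, exists2 n, (N <= n)%N & Q k n) -> exists2 phi, sincr phi & forall k, Q k (phi k).
Proof.
move=> H.
have [[k N]|F HF] := @choice _ _ (fun (p : nat * nat) n => (p.2 <= n)%N /\ Q p.1 n).
  by have [n ? ?] := H k N; exists n.
pose fix phi (n : nat) := if n is n'.+1 then F (n, (phi n').+1) else F (0, 0)%N.
exists phi => [n|[|n]]; first exact: (proj1 (HF (n.+1, (phi n).+1))).
- exact: (proj2 (HF (0, 0)%N)).
- exact: (proj2 (HF (n.+1, (phi n).+1))).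
Qed.

(** The diagonal is a subsequence of the j-th extraction only from some index on; hence stability is
    required under [esub] and not just under composition. *)
Lemma diagonal_subsequence (P : nat -> (nat -> nat) -> Prop) :
  (forall j phi, sincr phi -> exists2 psi, sincr psi & P j (phi \o psi)) ->
  (forall j phi psi, P j phi -> sincr psi -> esub psi phi -> P j psi) ->
  exists2 phi, sincr phi & forall j, P j phi.
Proof.
move=> H1 H2.
have [[j phi] /=|F HF] := @choice _ _ (fun (p : nat * (nat -> nat)) psi =>
    sincr p.2 -> sincr psi /\ P p.1 (p.2 \o psi)).
  have [/H1 H|H] := pselect (sincr phi); last by exists id.
  by have [psi ? ?] := H j; exists psi.
pose fix Phi (n : nat) : nat -> nat :=
  if n is n'.+1 then Phi n' \o F (n', Phi n') else id.
have Phi_incr n : sincr (Phi n).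
  by elim: n => [//|n IH] /=; apply: sincr_comp => //; have [] := HF (n, Phi n) IH.
have F_incr n : sincr (F (n, Phi n)) by have [] := HF (n, Phi n) (Phi_incr n).
have PPhi n : P n (Phi n.+1) by have [] := HF (n, Phi n) (Phi_incr n).
(* [P n] is known for [Phi n.+1], the stage after the n-th refinement. *)
pose phi n := Phi n.+1 n.
have sub j d n : exists2 n', (n <= n')%N & Phi (j + d)%N n = Phi j n'.
  elim: d n => [|d IH] n; first by exists n; rewrite ?addn0.
  rewrite addnS /=; have [n' n1 ->] := IH (F ((j + d)%N, Phi (j + d)%N) n).
  by exists n' => //; apply: leq_trans n1; apply: sincr_ge.
have phi_incr : sincr phi.
  move=> n; rewrite /phi; have := sub n.+1 1%N n.+1; rewrite addn1 => -[n' n1 ->].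
  exact: sincr_lt.
exists phi => // j; apply: H2 (PPhi j) phi_incr _ => N.
exists (maxn N j) => n; rewrite geq_max => /andP[Nn jn].
have [n' n1 E] := sub j.+1 (n - j)%N n; exists n'; first exact: leq_trans Nn n1.
by rewrite /phi -E addSn subnKC.
Qed.

End Subsequences.

Section Montel.
Context {R : realType}.
Local Notation C := (Cplx R).
Implicit Types (s t M e : R) (z w h : C) (f g u : C -> C).

Definition ccvg (u : nat -> C) (l : C) := forall e : R, 0 < e ->
  exists N, forall n, (N <= n)%N -> cabs (u n - l) < e.

Lemma ccvg_esub (u : nat -> C) l phi psi :
  ccvg (u \o phi) l -> esub psi phi -> ccvg (u \o psi) l.
Proof.
move=> H sub e /H [N HN]; have [N' HN'] := sub N; exists N' => n /HN' [n' ? E].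
by rewrite /= E; apply: HN.
Qed.

Lemma le_of_eps (x y : R) : (forall e : R, 0 < e -> x <= y + e) -> x <= y.
Proof. by move=> H; apply/ler_addgt0Pr. Qed.

Lemma ccvg_unique (u : nat -> C) l l' : ccvg u l -> ccvg u l' -> l = l'.
Proof.
move=> H H'; apply/eqP; rewrite -subr_eq0 -cabs_eq0 eq_le cabs_ge0 andbT.
apply: le_of_eps => e e0; rewrite add0r; have e20 : 0 < e / 2 by lra.
have [N HN] := H _ e20; have [N' HN'] := H' _ e20.
have := HN _ (leq_maxl N N'); have := HN' _ (leq_maxr N N').
move: (u _) => v h1 h2; have := cabs_trans l v l'; rewrite (cabsBC l v) => h3.
lra.
Qed.

Lemma bolzano_weierstrass_real (u : nat -> R) M : (forall n, `|u n| <= M) ->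
  exists phi (l : R), sincr phi /\ forall e : R, 0 < e ->
    exists N, forall n, (N <= n)%N -> `|u (phi n) - l| < e.
Proof.
move=> uM.
have [l [_ Hl]] : `[- M, M]%classic `&` cluster (u @ \oo) !=set0.
  apply: (@segment_compact R (- M) M).
  by exists 0%N => // n _ /=; rewrite in_itv /= -ler_norml.
have [|phi Hphi H] := @subseq_choose (fun k n => `|u n - l| < (k.+1%:R)^-1).
  move=> k N; have k0 : 0 < (k.+1%:R)^-1 :> R by rewrite invr_gt0.
  have [] := Hl (u @` [set n | (N <= n)%N]) (ball l (k.+1%:R)^-1).
  - by exists N => // n /= Nn; exists n.
  - exact: nbhsx_ballx.
  by move=> _ [[n /= Nn <-]]; rewrite /ball /= distrC; exists n.
exists phi, l; split=> // e e0.
exists (Num.bound e^-1) => n Hn; apply: lt_trans (H n) _.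
rewrite invf_plt ?posrE//; apply: lt_le_trans (archi_boundP _) _; first by rewrite invr_ge0 ltW.
by rewrite ler_nat ltnW.
Qed.

Lemma bolzano_weierstrass (u : nat -> C) M : (forall n, cabs (u n) <= M) ->
  exists phi (l : C), sincr phi /\ ccvg (u \o phi) l.
Proof.
move=> uM.
have [n|phi [x [Hphi Hx]]] := @bolzano_weierstrass_real (fun n => complex.Re (u n)) M.
  exact: le_trans (cabs_Re _) (uM n).
have [n|psi [y [Hpsi Hy]]] := @bolzano_weierstrass_real (fun n => complex.Im (u (phi n))) M.
  exact: le_trans (cabs_Im _) (uM _).
exists (phi \o psi), (x +i* y)%C; split; first exact: sincr_comp.
move=> e e0; have e20 : 0 < e / 2 by lra.
have [N HN] := Hx _ e20; have [N' HN'] := Hy _ e20.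
exists (maxn N N') => n; rewrite geq_max => /andP[n1 n2].
have h1 := HN (psi n) (leq_trans n1 (sincr_ge n Hpsi)); have h2 := HN' n n2.
apply: le_lt_trans (cabs_le_ReIm _) _; move: h1 h2 => /=.
by case: (u _) => x' y' /= ? ?; lra.
Qed.

Lemma coef_subsequence (a : nat -> nat -> C) (B : nat -> R) :
  (forall n j, cabs (a n j) <= B j) ->
  exists phi (b : nat -> C), sincr phi /\ forall j, ccvg (fun n => a (phi n) j) (b j).
Proof.
move=> aB.
have [||phi Hphi H] := @diagonal_subsequence
    (fun j phi => exists l, ccvg ((fun n => a n j) \o phi) l).
- move=> j phi Hphi.
  have [n|psi [l [Hpsi Hl]]] := @bolzano_weierstrass (fun n => a (phi n) j) (B j).
    exact: aB.
  by exists psi => //; exists l.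
- by move=> j phi psi [l Hl] _ sub; exists l; apply: ccvg_esub sub.
by have [b Hb] := choice H; exists phi, b.
Qed.

(** Convergence of each coefficient makes every fixed Taylor polynomial converge uniformly on the
    disc, and the remainders are small uniformly in n. *)
Lemma montel (F : nat -> C -> C) z s M (a : nat -> nat -> C) :
  0 < s -> 0 <= M -> (forall n, expands (F n) z s M (a n)) ->
  exists phi g b, [/\ sincr phi, expands g z s M b &
    forall e : R, 0 < e -> exists N, forall n, (N <= n)%N ->
      forall h, cabs h <= s / 2 -> cabs (F (phi n) (z + h) - g (z + h)) <= e].
Proof.
move=> s0 M0 Ha.
have [n j|phi [b [Hphi Hb]]] := @coef_subsequence a (fun j => 2 * M / (s / 2) ^+ j).
  exact: expands_coef (Ha n).
have sums k (e : R) : 0 < e -> exists N, forall n, (N <= n)%N -> forall h, cabs h <= s / 2 ->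
    cabs (\sum_(j < k) a (phi n) j * h ^+ j - \sum_(j < k) b j * h ^+ j) <= e.
  elim: k e => [|k IH] e e0.
    by exists 0%N => n _ h _; rewrite !big_ord0 subrr cabs0 ltW.
  have e20 : 0 < e / 2 by lra.
  have [N HN] := IH _ e20.
  have p0 : 0 < (s / 2) ^+ k by rewrite exprn_gt0 // divr_gt0.
  have [N' HN'] := Hb k _ (divr_gt0 e20 p0).
  exists (maxn N N') => n; rewrite geq_max => /andP[n1 n2] h hs.
  rewrite !big_ord_recr /= opprD addrACA -mulrBl.
  apply: le_trans (cabsD _ _) _; have := HN n n1 h hs.
  have : cabs ((a (phi n) k - b k) * h ^+ k) <= e / 2.
    rewrite cabsM cabsX; have := HN' n n2; rewrite ltr_pdivlMr// => /ltW; apply: le_trans.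
    by rewrite ler_wpM2l ?cabs_ge0// lerXn2r// ?nnegrE ?cabs_ge0// divr_ge0 // ltW.
  lra.
(* The value at h is a limit along a further subsequence depending on h. This is harmless: the
   estimates for all N, inherited in the limit, determine the value. Off the disc the default is
   0. *)
have [h|G HG] := @choice _ _ (fun (h l : C) => cabs h <= s / 2 -> forall N,
    cabs (l - \sum_(j < N) b j * h ^+ j) <= M * (cabs h / s) ^+ N).
  have [hs|hs] := boolP (cabs h <= s / 2); last by exists 0.
  have [n|psi [l [Hpsi Hl]]] := @bolzano_weierstrass (fun n => F (phi n) (z + h)) M.
    by have := Ha (phi n) 0%N h hs; rewrite big_ord0 subr0 expr0 mulr1.
  exists l => _ N; apply: le_of_eps => e e0; have e20 : 0 < e / 2 by lra.
  have [N1 HN1] := Hl _ e20; have [N2 HN2] := sums N _ e20.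
  have := HN1 _ (leq_maxl N1 N2); set n := maxn N1 N2 => l1.
  have := HN2 (psi n) (leq_trans (leq_maxr N1 N2) (sincr_ge n Hpsi)) h hs => l2.
  have l3 := Ha (phi (psi n)) N h hs; rewrite /= in l1.
  have := cabs_trans l (F (phi (psi n)) (z + h)) (\sum_(j < N) b j * h ^+ j).
  have := cabs_trans (F (phi (psi n)) (z + h)) (\sum_(j < N) a (phi (psi n)) j * h ^+ j)
    (\sum_(j < N) b j * h ^+ j).
  by rewrite (cabsBC l (F _ _)); move=> *; lra.
exists phi, (fun w => G (w - z)), b; split=> //.
  by move=> N h hs; rewrite addrAC subrr add0r; apply: HG.
move=> e e0; have e40 : 0 < e / 4 by lra.
(* The order k makes both Taylor remainders smaller than e / 4; the polynomials of that order
   contribute another e / 4. *)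
have [k Hk] := small_geom M0 e40; have [N HN] := sums k _ e40.
exists N => n Nn h hs; rewrite (addrAC z h) subrr add0r.
have g1 : M * (cabs h / s) ^+ k <= M / 2 ^+ k.
  have le2 : cabs h / s <= 2^-1 by rewrite ler_pdivrMr// mulrC.
  have ge0 : 0 <= cabs h / s by rewrite divr_ge0 ?cabs_ge0 ?ltW.
  by rewrite ler_wpM2l// -exprVn; apply: lerXn2r; rewrite ?nnegrE// invr_ge0.
have := HN n Nn h hs; have := Ha (phi n) k h hs; have := HG h hs k.
have := cabs_trans (F (phi n) (z + h)) (\sum_(j < k) a (phi n) j * h ^+ j) (G h).
have := cabs_trans (\sum_(j < k) a (phi n) j * h ^+ j) (\sum_(j < k) b j * h ^+ j) (G h).
by rewrite (cabsBC (\sum_(j < k) b j * h ^+ j) (G h)); move=> *; lra.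
Qed.

Lemma expands_limit (F : nat -> C -> C) f z s M (a : nat -> nat -> C) :
  0 < s -> 0 <= M -> (forall n, expands (F n) z s M (a n)) ->
  (forall h, cabs h <= s / 2 -> ccvg (fun n => F n (z + h)) (f (z + h))) ->
  exists b, expands f z s M b.
Proof.
move=> s0 M0 Ha Hf; have [phi [g [b [Hphi Hg Hu]]]] := montel s0 M0 Ha.
exists b => N h hs; suff -> : f (z + h) = g (z + h) by apply: Hg.
have H1 : ccvg ((fun n => F n (z + h)) \o phi) (f (z + h)).
  exact: (@ccvg_esub (fun n => F n (z + h)) _ id phi (Hf h hs) (@esub_comp id phi Hphi)).
apply: ccvg_unique H1 _ => e e0.
have [|N' HN'] := Hu (e / 2) _; first by lra.
exists N' => n Nn; apply: le_lt_trans (HN' n Nn h hs) _; lra.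
Qed.

(* [f'] is the pointwise limit of difference quotients with a common [expands] bound. *)
Lemma derive1_holo (D : set C) f z : open D -> D z ->
  (forall w, D w -> exists k, cderiv f w k) -> exists k, cderiv (derive1 f) z k.
Proof.
move=> oD Dz df; have [r r0 Hr] := open_cball oD Dz.
have [k0 Hk0] := df z Dz.
have [r' r'0 Hr'] := cderiv_cont Hk0 ltr01.
(* Room for two steps: squares of half-side s around points at distance 2 s from z stay within 4 s,
   where f is differentiable and bounded by B. *)
pose s := Num.min r r' / 8; pose B := cabs (f z) + 1.
have B0 : 0 <= B by have := cabs_ge0 (f z); rewrite /B; lra.
have m0 : 0 < Num.min r r' by rewrite lt_min r0.
have s0 : 0 < s by rewrite /s; lra.
have [sr sr'] : 8 * s <= r /\ 8 * s <= r'.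
  have E : 8 * s = Num.min r r' by rewrite /s; field.
  by rewrite E !ge_min !lexx orbT.
have near_D w : cabs (w - z) <= 4 * s -> D w by move=> ws; apply: Hr; lra.
have near_B w : cabs (w - z) <= 4 * s -> cabs (f w) <= B.
  move=> ws; have /Hr' : cabs (w - z) < r' by lra.
  by have := cabsD (f w - f z) (f z); rewrite subrK /B; lra.
(* A Lipschitz constant independent of w, which bounds all difference quotients [F n] at once. *)
have lip w h : cabs (w - z) <= 2 * s -> cabs h <= s / 2 -> cabs (f (w + h) - f w) <= 16 * B / s * cabs h.
  move=> ws hs.
  have far x : cabs (x - w) <= 2 * s -> cabs (x - z) <= 4 * s.
    by have := cabs_trans x w z; lra.
  have [a Ha] := holo_expands s0 B0 (fun x xw => df x (near_D x (far x xw)))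
    (fun x xw => near_B x (far x xw)).
  exact: expands_lip Ha hs.
pose h n : C := (s / 2 / n.+1%:R)%:C.
have habs n : cabs (h n) = s / 2 / n.+1%:R by rewrite cabs_real ger0_norm// !divr_ge0// ltW.
have hs n : cabs (h n) <= s / 2.
  by rewrite habs ler_pdivrMr// ler_peMr ?ler1n// divr_ge0// ltW.
have h0 n : h n != 0 by rewrite -cabs_gt0 habs !divr_gt0.
pose F n w := (h n)^-1 * (f (w + h n) - f w).
have K0 : 0 <= 16 * B / s by apply: divr_ge0; [apply: mulr_ge0|exact: ltW].
have Fdiff n w : cabs (w - z) <= 2 * s -> exists k, cderiv (F n) w k.
  move=> ws; have [|k1 Hk1] := df (w + h n).
    apply: near_D; have := cabsD (w - z) (h n); rewrite addrAC.
    by have := hs n; lra.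
  have [|k2 Hk2] := df w; first by apply: near_D; lra.
  by eexists; exact: cderivZ (cderivB (cderiv_shift Hk1) Hk2).
have Fbound n w : cabs (w - z) <= 2 * s -> cabs (F n w) <= 16 * B / s.
  move=> ws; rewrite cabsM cabsV ler_pdivrMl ?cabs_gt0// mulrC.
  exact: lip.
have [n|a Ha] := @choice _ _ (fun n a => expands (F n) z s (16 * (16 * B / s)) a).
  by apply: holo_expands; [|exact: K0|exact: Fdiff|exact: Fbound].
have KK0 : 0 <= 16 * (16 * B / s) by rewrite mulr_ge0.
have [|b /(expands_cderiv s0 KK0) Hb] := @expands_limit F (derive1 f) z s _ a s0 KK0 Ha.
  move=> x xs e e0.
  have [|l Hl] := df (z + x); first by apply: near_D; rewrite addrAC subrr add0r; lra.
  rewrite (cderiv_derive1 Hl).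
  have e20 : 0 < e / 2 by lra.
  have [r1 r10 Hr1] := Hl _ e20.
  exists (Num.bound (s / 2 / r1)) => n Hn.
  have hr : cabs (h n) < r1.
    rewrite habs ltr_pdivrMr// [r1 * _]mulrC -ltr_pdivrMr//.
    apply: lt_le_trans (archi_boundP _) _; first by apply: divr_ge0; [apply: divr_ge0 => //; exact: ltW|exact: ltW].
    by rewrite ler_nat ltnW.
  have := Hr1 (z + x + h n); rewrite [z + x + h n - _]addrC addKr => /(_ hr) H.
  have -> : F n (z + x) - l = (h n)^-1 * (f (z + x + h n) - f (z + x) - l * h n).
    by rewrite /F; move: (h n) (h0 n) => y y0; field.
  rewrite cabsM cabsV ltr_pdivrMl ?cabs_gt0//; apply: le_lt_trans H _.
  by rewrite mulrC ltr_pM2l ?cabs_gt0//; lra.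
by exists (b 1%N).
Qed.

End Montel.

(** * Quasi-normality *)

Section LocalDichotomy.
Context {R : realType}.
Local Notation C := (Cplx R).
Implicit Types (s t M e : R) (z w h x : C) (f g : C -> C).

Definition smooth_ball f z s := forall j w, cabs (w - z) <= s ->
  cderiv (derive1n j f) w (derive1n j.+1 f w).

Lemma holo_derive1n (D : set C) f j w : open D -> holomorphic_on D f -> D w ->
  cderiv (derive1n j f) w (derive1n j.+1 f w).
Proof.
move=> oD hf; elim: j w => [|j IH] w Dw; first exact: derivable_cderiv (hf w Dw).
have [|k Hk] := @derive1_holo R D (derive1n j f) w oD Dw.
  by move=> x Dx; eexists; exact: IH.
by rewrite [derive1n j.+2 f](_ : _ = derive1 (derive1n j.+1 f))// (cderiv_derive1 Hk).
Qed.

(** The hypothesis bounds f by itself. With M the maximum of |f| on the segment from z to w and m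
    the sum of derivatives at z, k integrations starting at z yield M <= m + s K (1 + M) <= m + (1 +
    M) / 2, which is solved for M. The condition s <= 1 allows powers of |h| to be dropped. *)
Lemma growth_bound f z s (K : R) k : 0 < s -> s <= 1 -> 0 <= K -> K * s <= 1 / 2 ->
  (0 < k)%N -> smooth_ball f z s ->
  (forall w, cabs (w - z) <= s -> cabs (derive1n k f w) <= K * (1 + cabs (f w))) ->
  forall w, cabs (w - z) <= s ->
    cabs (f w) <= 2 * \sum_(0 <= j < k) cabs (derive1n j f z) + 1.
Proof.
move=> s0 s1 K0 Ks; case: k => // k _ sm kb w ws.
pose h := w - z; have hs : cabs h <= s by [].
have onray t : 0 <= t <= 1 -> cabs (z + t%:C * h - z) <= s.
  move=> /andP[t0 t1]; rewrite addrAC subrr add0r cabsM cabs_real ger0_norm//.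
  by apply: le_trans hs; have := cabs_ge0 h; nra.
have dray j t : 0 <= t <= 1 ->
    rderiv (fun t => derive1n j f (z + t%:C * h)) t (h * derive1n j.+1 f (z + t%:C * h)).
  by move=> /onray/(sm j)/cderiv_line.
have [||c c01 Hc] := @EVT_max R (fun t => cabs (f (z + t%:C * h))) 0 1; first exact: ler01.
  apply: continuous_in_subspaceT => t; rewrite inE /= in_itv /= => t01.
  apply/cvgrPdist_lt => e e0; have [d d0 Hd] := cderiv_cont (sm 0%N _ (onray t t01)) e0.
  apply/nearRP; exists (d / (1 + cabs h)); first by rewrite divr_gt0// ltr_pwDl ?cabs_ge0.
  move=> t' ht'; have : cabs (z + t'%:C * h - (z + t%:C * h)) < d.
    have -> : z + t'%:C * h - (z + t%:C * h) = (t' - t)%:C * h by rewrite rmorphB; ring.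
    rewrite cabsM cabs_real; move: ht'; rewrite ltr_pdivlMr ?ltr_pwDl ?cabs_ge0//.
    apply: le_lt_trans; have := normr_ge0 (t' - t); lra.
  move=> /Hd /= H; rewrite distrC ltr_norml; apply/andP; split.
    have := cabs_sub_ge (f (z + t%:C * h)) (f (z + t'%:C * h)); rewrite cabsBC; lra.
  have := cabs_sub_ge (f (z + t'%:C * h)) (f (z + t%:C * h)); lra.
rewrite in_itv /= in c01; set M := cabs (f (z + c%:C * h)) in Hc.
have M0 : 0 <= M by apply: cabs_ge0.
have fM t : 0 <= t <= 1 -> cabs (f (z + t%:C * h)) <= M by move=> t01; apply: Hc; rewrite in_itv.
have step j B : 0 <= B -> (forall t, 0 <= t <= 1 -> cabs (derive1n j.+1 f (z + t%:C * h)) <= B) ->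
    forall t, 0 <= t <= 1 -> cabs (derive1n j f (z + t%:C * h)) <= cabs (derive1n j f z) + cabs h * B.
  move=> B0 HB t /andP[t0 t1].
  have := @mean_value_ineq R 0 t _ (fun t => derive1n j f (z + t%:C * h)) (cabs h * B) t0.
  move=> /(_ (fun t => h * derive1n j.+1 f (z + t%:C * h)) _ _) H.
  have {}H := H _ _; rewrite mul0r addr0 subr0 in H.
  have := cabsD (derive1n j f (z + t%:C * h) - derive1n j f z) (derive1n j f z).
  rewrite subrK => /le_trans; apply; rewrite [leLHS]addrC lerD2l.
  apply: le_trans (H _ _) _.
  - by move=> r /andP[r0 r1]; apply: dray; lra.
  - by move=> r /andP[r0 r1]; rewrite cabsM ler_wpM2l ?cabs_ge0// HB//; lra.
  - by rewrite ler_piMr// mulr_ge0 ?cabs_ge0.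
(* Only the top-order term keeps a factor |h|, as this is what K s <= 1 / 2 absorbs. [main] then
   descends through the orders of the derivatives. *)
pose Q := cabs h * (K * (1 + M)).
have Q0 : 0 <= Q by rewrite !mulr_ge0 ?cabs_ge0//; lra.
have main i : (i <= k)%N -> forall t, 0 <= t <= 1 ->
    cabs (derive1n (k - i) f (z + t%:C * h)) <= \sum_(k - i <= j < k.+1) cabs (derive1n j f z) + Q.
  elim: i => [|i IH] ik t t01.
    rewrite subn0 big_nat1; apply: step t01 => [|r r01]; first by rewrite mulr_ge0//; lra.
    apply: le_trans (kb _ (onray r r01)) _.
    by rewrite ler_wpM2l// lerD2l fM.
  have E : (k - i.+1).+1 = (k - i)%N by rewrite subnSK.
  rewrite big_ltn ?ltnS ?leq_subr// E -addrA.
  set S := \sum_(_ <= j < _) _ + Q.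
  have S0 : 0 <= S by rewrite addr_ge0// sumr_ge0// => *; apply: cabs_ge0.
  apply: le_trans (step _ S S0 _ t t01) _; first by rewrite E; apply: IH; rewrite ltnW.
  by rewrite lerD2l ler_piMl//; apply: le_trans hs s1.
have := main k (leqnn k) c c01; rewrite subnn -/M.
have Q1 : Q <= (1 + M) / 2.
  have : cabs h * K <= 1 / 2 by apply: le_trans Ks; rewrite mulrC ler_wpM2l.
  by rewrite /Q mulrA => ?; nra.
have := fM 1; rewrite mul1r /h addrC subrK ler01 lexx => /(_ isT).
rewrite -/M; lra.
Qed.

Lemma derive1n_bound z s j : 0 < s -> exists2 K : R, 0 <= K & forall f M, 0 <= M ->
  smooth_ball f z s -> (forall w, cabs (w - z) <= s -> cabs (f w) <= M) ->
  cabs (derive1n j f z) <= K * M.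
Proof.
move=> s0.
(* For the induction the estimate must hold on a disc; each application of [derive1_bound] halves
   its radius. *)
suff [K K0 HK] : exists2 K : R, 0 <= K & forall f M, 0 <= M -> smooth_ball f z s ->
    (forall w, cabs (w - z) <= s -> cabs (f w) <= M) ->
    forall w, cabs (w - z) <= s / 2 ^+ j -> cabs (derive1n j f w) <= K * M.
  exists K => // f M M0 sm fM; apply: HK => //.
  by rewrite subrr cabs0 divr_ge0 ?exprn_ge0// ltW.
elim: j => [|j [K K0 HK]].
  by exists 1 => // f M M0 _ fM w; rewrite expr0 divr1 mul1r; apply: fM.
have sj : 0 < s / 2 ^+ j by rewrite divr_gt0 ?exprn_gt0.
have sjs : s / 2 ^+ j <= s by rewrite ler_pdivrMr ?exprn_gt0// -[leLHS]mulr1 ler_pM2l// exprn_ege1// ler1n.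
exists (256 / (s / 2 ^+ j) * K); first by apply: mulr_ge0 => //; apply: divr_ge0; [exact: ler0n|exact: ltW].
move=> f M M0 sm fM w ws; rewrite -(mulrA (256 / _) K M).
have H : cabs (derive1 (derive1n j f) w) <= 256 / (s / 2 ^+ j) * (K * M).
  apply: derive1_bound sj _ _ _ _; first exact: mulr_ge0.
  - by move=> x xs; eexists; apply: sm; apply: le_trans xs sjs.
  - exact: HK.
  - by apply: le_trans ws _; rewrite exprSr invfM mulrA.
exact: H.
Qed.

Lemma expands_zero g z s M b h : 0 < s -> 0 <= M -> expands g z s M b -> (forall j, b j = 0) ->
  cabs h <= s / 2 -> g (z + h) = 0.
Proof.
move=> s0 M0 Hg b0 hs; apply/eqP; rewrite -cabs_eq0 eq_le cabs_ge0 andbT.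
apply: le_of_eps => e e0; rewrite add0r; have [N HN] := small_geom M0 e0.
have := Hg N h hs; rewrite big1 ?subr0 => [H|i _]; last by rewrite b0 mul0r.
apply: le_trans H _; apply: le_trans (ltW HN).
have le2 : cabs h / s <= 2^-1 by rewrite ler_pdivrMr// mulrC.
have ge0 : 0 <= cabs h / s by rewrite divr_ge0 ?cabs_ge0 ?ltW.
by rewrite ler_wpM2l// -exprVn; apply: lerXn2r; rewrite ?nnegrE// invr_ge0.
Qed.

(** Quantitative isolation of zeros: close to z the first nonzero term is at least twice the
    remainder of order p + 1, and [d'] is the radius at which this begins. *)
Lemma expands_lower_bound g z s M b p : 0 < s -> 0 <= M -> expands g z s M b ->
  (forall j, (j < p)%N -> b j = 0) -> b p != 0 ->
  exists d c : R, [/\ 0 < d, 0 < c, d <= s / 2 &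
    forall h, cabs h < d -> c * cabs h ^+ p <= cabs (g (z + h))].
Proof.
move=> s0 M0 Hg b0 bp; have bp0 : 0 < cabs (b p) by rewrite cabs_gt0.
have sp : 0 < s ^+ p.+1 by rewrite exprn_gt0.
pose d' := cabs (b p) * s ^+ p.+1 / (2 * (M + 1)).
have M1 : 0 < 2 * (M + 1) by lra.
have d'0 : 0 < d' by rewrite divr_gt0// mulr_gt0.
exists (Num.min (s / 2) d'), (cabs (b p) / 2); split.
- by rewrite lt_min d'0 divr_gt0.
- by rewrite divr_gt0.
- by rewrite ge_min lexx.
move=> h; rewrite lt_min => /andP[/ltW hs hd].
have := Hg p.+1 h hs; rewrite big_ord_recr big1 /= => [H|i _]; last by rewrite b0 ?mul0r.
rewrite add0r expr_div_n in H.
have hp : 0 <= cabs h ^+ p by rewrite exprn_ge0 ?cabs_ge0.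
have rem : M * (cabs h ^+ p.+1 / s ^+ p.+1) <= cabs (b p) / 2 * cabs h ^+ p.
  rewrite exprS !mulrA ler_pdivrMr//.
  have : M * cabs h <= cabs (b p) / 2 * s ^+ p.+1.
    move: hd; rewrite /d' ltr_pdivlMr//; have := cabs_ge0 h; nra.
  by move=> /(ler_wpM2r hp) H'; rewrite [leRHS]mulrAC.
have := cabs_sub_ge (b p * h ^+ p) (b p * h ^+ p - g (z + h)).
rewrite opprB addrCA subrr addr0 cabsM cabsX [cabs (_ - g _)]cabsBC; lra.
Qed.

(** Spherical uniform convergence near w, split according to a finite limit or the constant limit
    infinity. The function g may depend on w, so the property survives gluing and extraction. *)
Definition good_at (u : nat -> C -> C) w :=
  (exists2 d : R, 0 < d & exists g, forall e : R, 0 < e -> exists N, forall n, (N <= n)%N ->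
     forall x, cabs (x - w) < d -> cabs (u n x - g x) <= e) \/
  (exists2 d : R, 0 < d & forall B : R, exists N, forall n, (N <= n)%N ->
     forall x, cabs (x - w) < d -> B <= cabs (u n x)).

Lemma good_at_infinity (u : nat -> C -> C) (mu : nat -> R) g x d c : 0 < d -> 0 < c ->
  (forall n, n.+1%:R < mu n) -> (forall y, cabs (y - x) < d -> c <= cabs (g y)) ->
  (forall e : R, 0 < e -> exists N, forall n, (N <= n)%N -> forall y, cabs (y - x) < d ->
    cabs (((mu n)^-1)%:C * u n y - g y) <= e) ->
  good_at u x.
Proof.
move=> d0 c0 mun gc Hg; right; exists d => // B.
have c20 : 0 < c / 2 by lra.
have [N HN] := Hg _ c20.
(* From here on |u n| >= (c / 2) mu n, and mu n > n + 1 exceeds |B| / (c / 2). *)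
exists (maxn N (Num.bound (`|B| / (c / 2)))) => n; rewrite geq_max => /andP[Nn Bn] y yx.
have mu0 : 0 < mu n by apply: lt_trans (mun n).
have h1 := gc y yx; have h2 := HN n Nn y yx.
have h3 := cabs_sub_ge (g y) (((mu n)^-1)%:C * u n y).
rewrite (cabsBC (g y)) cabsM cabs_real ger0_norm in h3; last by rewrite invr_ge0 ltW.
have : c / 2 <= (mu n)^-1 * cabs (u n y) by clear - h1 h2 h3; lra.
rewrite [(mu n)^-1 * _]mulrC ler_pdivlMr//; apply: le_trans; apply: le_trans (ler_norm B) _.
rewrite [leRHS]mulrC -ler_pdivrMr//.
apply: le_trans (ltW (archi_boundP _)) _; first by apply: divr_ge0 => //; exact: ltW.
by apply: le_trans (ltW (mun n)); rewrite ler_nat; apply: leqW.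
Qed.

(** A single subsequence serves all w in the smaller disc, each w being the only possible exception
    in a neighbourhood of itself. The radius s / 16 keeps z well inside the discs of expansion
    around w. *)
Lemma local_dichotomy (f : nat -> C -> C) z s (K : R) k :
  0 < s -> s <= 1 -> 0 <= K -> K * s <= 1 / 2 -> (0 < k)%N ->
  (forall n, smooth_ball (f n) z s) ->
  (forall n w, cabs (w - z) <= s -> cabs (derive1n k (f n) w) <= K * (1 + cabs (f n w))) ->
  exists2 psi, sincr psi & forall w, cabs (w - z) < s / 16 ->
    exists2 d : R, 0 < d & forall x, x != w -> cabs (x - w) < d -> good_at (f \o psi) x.
Proof.
move=> s0 s1 K0 Ks k0 sm kb.
pose m n := \sum_(0 <= j < k) cabs (derive1n j (f n) z).
have m0 n : 0 <= m n by rewrite sumr_ge0// => *; apply: cabs_ge0.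
have fm n w : cabs (w - z) <= s -> cabs (f n w) <= 2 * m n + 1.
  exact: growth_bound s0 s1 K0 Ks k0 (sm n) (kb n) w.
have df n w : cabs (w - z) <= s -> exists k, cderiv (f n) w k.
  by move=> /(sm n 0%N); eexists; eassumption.
pose r := s / 4; have r0 : 0 < r by rewrite /r; lra.
have near_w w x : cabs (w - z) < s / 16 -> cabs (x - w) <= 2 * r -> cabs (x - z) <= s.
  by have := cabs_trans x w z; rewrite /r; lra.
(* Either m(f_n) <= B for infinitely many n with some fixed B, or m(f_n) tends to infinity. *)
have [[B HB]|noB] := pselect (exists B, forall N, exists2 n, (N <= n)%N & m n <= B).
  have [|phi Hphi mB] := @subseq_choose (fun _ n => m n <= B); first by move=> _ N; exact: HB.
  have B0 : 0 <= B by apply: le_trans (mB 0%N).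
  have [n|a Ha] := @choice _ _ (fun n a => expands (f (phi n)) z r (16 * (2 * B + 1)) a).
    apply: holo_expands => //; first by lra.
      by move=> w ws; apply: df; apply: near_w ws; rewrite subrr cabs0; lra.
    move=> w ws; apply: le_trans (fm _ _ _) _; last by have := mB n; lra.
    by apply: near_w ws; rewrite subrr cabs0; lra.
  have M0 : 0 <= 16 * (2 * B + 1) by lra.
  have [phi' [g [b [Hphi' _ Hg]]]] := montel r0 M0 Ha.
  exists (phi \o phi'); first exact: sincr_comp.
  move=> w wz; exists (s / 16); first by lra.
  move=> x _ xw; left; exists (s / 8 - cabs (x - z)).
    by have := cabs_trans x w z; lra.
  exists g => e /Hg [N HN]; exists N => n Nn y yx.
  have := HN n Nn (y - z); rewrite [z + _]addrC subrK; apply.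
  by have := cabs_trans y x z; rewrite /r; lra.
have big B : exists N, forall n, (N <= n)%N -> B < m n.
  apply: contrapT => H; apply: noB; exists B => N; apply: contrapT => H'.
  by apply: H; exists N => n Nn; rewrite ltNge; apply/negP => mB; apply: H'; exists n.
have [|phi Hphi mphi] := @subseq_choose (fun i n => i.+1%:R < m n).
  by move=> i N; have [N' H] := big i.+1%:R; exists (maxn N N'); rewrite ?leq_maxl// H ?leq_maxr.
have mphi1 n : 1 < m (phi n) by apply: le_lt_trans (mphi n); rewrite ler1n.
pose F n w : C := ((m (phi n))^-1)%:C * f (phi n) w.
have cF n w : cabs (F n w) = cabs (f (phi n) w) / m (phi n).
  by rewrite cabsM cabs_real ger0_norm ?invr_ge0// mulrC.
have F3 n w : cabs (w - z) <= s -> cabs (F n w) <= 3.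
  move=> /(fm (phi n)); have := mphi1 n; rewrite cF ler_pdivrMr; last by have := mphi1 n; lra.
  lra.
have dF n w : cabs (w - z) <= s -> exists k, cderiv (F n) w k.
  by move=> /(df (phi n)) [l Hl]; eexists; exact: cderivZ Hl.
have expF w : cabs (w - z) < s / 16 -> exists a, forall n, expands (F n) w r (16 * 3) (a n).
  move=> wz; have [n|a Ha] := @choice _ _ (fun n a => expands (F n) w r (16 * 3) a); last by exists a.
  apply: holo_expands => // x xw; [exact: dF (near_w w x wz xw)|exact: F3 (near_w w x wz xw)].
have M48 : 0 <= 16 * 3 :> R by lra.
have zz : cabs (z - z) < s / 16 by rewrite subrr cabs0; lra.
have [a Ha] := expF z zz.
have [phi1 [g [b [Hphi1 _ Hg]]]] := montel r0 M48 Ha.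
exists (phi \o phi1); first exact: sincr_comp.
move=> w wz; have [a' Ha'] := expF w wz.
(* The extraction [phi2] depends on w and is not part of the final subsequence; it only supplies an
   expansion around w of a function G that agrees with g near w. *)
have [phi2 [G [b' [Hphi2 Gexp HG]]]] := montel r0 M48 (fun n => Ha' (phi1 n)).
have gG h : cabs h <= s / 16 -> g (w + h) = G (w + h).
  move=> hs.
  have c1 : ccvg ((fun n => F (phi1 n) (w + h)) \o phi2) (g (w + h)).
    apply: (@ccvg_esub _ (fun n => F (phi1 n) (w + h)) _ id phi2); last exact: (@esub_comp id phi2).
    move=> e e0; have [|N HN] := Hg (e / 2); first lra.
    exists N => n Nn; have := HN n Nn (w + h - z).
    rewrite [z + _]addrC subrK => H; apply: le_lt_trans (H _) _; last by lra.
    by have := cabsD (w - z) h; rewrite /r addrAC; lra.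
  apply: ccvg_unique c1 _ => e e0; have [|N HN] := HG (e / 2); first lra.
  exists N => n Nn; apply: le_lt_trans (HN n Nn h _) _; rewrite /r; lra.
(* If all coefficients vanish, G is 0 on the disc of radius r / 2 = s / 8 around w, which contains
   the disc of radius s / 16 around z. *)
have [ball0|/existsNP [q /eqP bq]] := pselect (forall j, b' j = 0).
  exfalso.
  have s16 : 0 < s / 16 by lra.
  have [KK HKK] := choice (fun j => let: ex_intro2 K K0 H := @derive1n_bound z (s / 16) j s16 in
    ex_intro _ K (conj K0 H)).
  pose KS := \sum_(0 <= j < k) KK j.
  have KS0 : 0 <= KS by rewrite sumr_ge0// => j _; have [] := HKK j.
  (* [KS] sums the Cauchy constants of orders below k, so this tolerance gives m <= m / 2 for some m
     > 1. *)
  have [|N HN] := HG (1 / (2 * (KS + 1))); first by rewrite divr_gt0//; lra.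
  have {}HN := HN N (leqnn N); set n := phi1 (phi2 N) in HN.
  set e := 1 / _ in HN; have e0 : 0 <= e by rewrite divr_ge0//; lra.
  have fe x : cabs (x - z) <= s / 16 -> cabs (f (phi n) x) <= m (phi n) * e.
    move=> xz; have xw : cabs (x - w) <= r / 2.
      by have := cabs_trans x z w; rewrite (cabsBC z w) /r; lra.
    have := HN (x - w) xw; rewrite (expands_zero r0 M48 Gexp ball0 xw) subr0 [w + _]addrC subrK.
    by rewrite cF ler_pdivrMr 1?mulrC//; have := mphi1 n; lra.
  have : m (phi n) <= KS * (m (phi n) * e).
    rewrite /KS mulr_suml; apply: ler_sum => j _; have [_ HK] := HKK j; apply: HK => //.
      by rewrite mulr_ge0.
    by move=> i x xz; apply: sm; lra.
  have := mphi1 n; have : KS * e <= 1 / 2.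
    by rewrite /e mulrA ler_pdivrMr; lra.
  move=> h1 h2; rewrite mulrCA => h3; nra.
have [p bp pmin] := @ex_minnP (fun j => b' j != 0) (ex_intro _ q bq).
have [|d [c [d0 c0 dr low]]] := expands_lower_bound (p := p) r0 M48 Gexp _ bp.
  by move=> j jp; apply/eqP; apply: contraTT jp => /pmin; rewrite -leqNgt.
exists (Num.min d (s / 16)); first by rewrite lt_min d0; lra.
move=> x xw; rewrite lt_min => /andP[xd xs].
have xw0 : 0 < cabs (x - w) by rewrite cabs_gt0 subr_eq0.
(* Small enough to stay inside both discs around w and at least half as far from w as x, where the
   lower bound on g is a positive constant. *)
pose eta := Num.min (cabs (x - w) / 2) (Num.min (d - cabs (x - w)) (s / 16 - cabs (x - w))).
have eta0 : 0 < eta by rewrite !lt_min !subr_gt0 xd xs divr_gt0.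
have x20 : 0 < cabs (x - w) / 2 by rewrite divr_gt0.
have near_x y : cabs (y - x) < eta ->
    [/\ cabs (y - w) < d, cabs (y - w) < s / 16 & cabs (x - w) / 2 <= cabs (y - w)].
  rewrite !lt_min => /andP[y1 /andP[y2 y3]].
  have tri1 := cabs_trans y x w; have tri2 := cabs_trans x y w; rewrite (cabsBC x y) in tri2.
  by clear - y1 y2 y3 tri1 tri2; split; lra.
apply: (@good_at_infinity _ (fun n => m (phi (phi1 n))) g x eta (c * (cabs (x - w) / 2) ^+ p)) => //.
- by rewrite mulr_gt0// exprn_gt0.
- by move=> n; apply: le_lt_trans (mphi _); rewrite ler_nat ltnS sincr_ge.
- move=> y /near_x [yd ys yx].
  have := low (y - w) yd; rewrite -(gG _ (ltW ys)) [w + _]addrC subrK; apply: le_trans.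
  by rewrite ler_pM2l//; apply: lerXn2r; rewrite ?nnegrE ?cabs_ge0// ltW.
move=> e /Hg [N HN]; exists N => n Nn y /near_x [_ ys _].
have := HN n Nn (y - z); rewrite [z + _]addrC subrK; apply.
have := cabs_trans y w z; rewrite /r; clear - ys wz s0; move=> *; lra.
Qed.

End LocalDichotomy.

(** * Spherical limits and passage from discs to the domain *)

Section QuasiNormality.
Context {R : realType}.
Local Notation C := (Cplx R).
Implicit Types (s t M e : R) (z w h x : C) (f g : C -> C).

Lemma good_at_esub (f : nat -> C -> C) phi psi w :
  good_at (f \o phi) w -> esub psi phi -> good_at (f \o psi) w.
Proof.
move=> H sub; case: H => [[d d0 [g Hg]]|[d d0 HB]]; [left; exists d => //; exists g => e e0|right; exists d => // B].
- have [N HN] := Hg e e0; have [N' HN'] := sub N.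
  by exists N' => n /HN' [n' n1 E] x xw; rewrite /= E; apply: HN.
- have [N HN] := HB B; have [N' HN'] := sub N.
  by exists N' => n /HN' [n' n1 E] x xw; rewrite /= E; apply: HN.
Qed.

Lemma family_bound (D : set C) k (K : R) f w : family_Fk D k K f -> D w ->
  cabs (derive1n k f w) <= K * (1 + cabs (f w)).
Proof.
move=> [_ H] /H; rewrite !norm_cabs.
have p0 : 0 < 1 + cabs (f w) by rewrite ltr_pwDl ?cabs_ge0.
have -> : 1 + (cabs (f w))%:C = (1 + cabs (f w))%:C :> C by rewrite rmorphD.
rewrite -fmorphV -rmorphM lecR.
by rewrite ler_pdivrMr.
Qed.

Lemma rational_approx z e : 0 < e -> exists p q : rat,
  cabs (z - (ratr p +i* ratr q)%C) < e.
Proof.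
move=> e0; case: z => x y.
have [|p] := @rat_in_itvoo R (x - e / 2) (x + e / 2); first lra.
have [|q] := @rat_in_itvoo R (y - e / 2) (y + e / 2); first lra.
rewrite !in_itv /= => /andP[q1 q2] /andP[p1 p2]; exists p, q.
apply: le_lt_trans (cabs_le_ReIm _) _ => /=.
have : `|x - ratr p| < e / 2 by rewrite ltr_norml; lra.
have : `|y - ratr q| < e / 2 by rewrite ltr_norml; lra.
lra.
Qed.

Lemma sqrt1D_ge (u : C) : 1 <= Num.sqrt (1 + cabs u ^+ 2) /\ cabs u <= Num.sqrt (1 + cabs u ^+ 2).
Proof.
have u2 := sqr_ge0 (cabs u); have u0 := cabs_ge0 u.
have S0 := sqrtr_ge0 (1 + cabs u ^+ 2).
have S2 : Num.sqrt (1 + cabs u ^+ 2) ^+ 2 = 1 + cabs u ^+ 2 by rewrite sqr_sqrtr// addr_ge0.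
by split; rewrite -ler_sqr ?nnegrE// S2 ?expr1n; lra.
Qed.

Lemma chordal_le (u v : C) : chordal (Some u) (Some v) <= 2 * cabs (u - v).
Proof.
rewrite /=; have [s1 _] := sqrt1D_ge u; have [s2 _] := sqrt1D_ge v.
have p : 1 <= Num.sqrt (1 + cabs u ^+ 2) * Num.sqrt (1 + cabs v ^+ 2) by apply: mulr_ege1.
rewrite ler_pdivrMr; last lra.
by rewrite ler_peMr// mulr_ge0 ?cabs_ge0.
Qed.

Lemma chordal_inf (u : C) e : 0 < e -> 2 / e + 1 <= cabs u -> chordal (Some u) None < e.
Proof.
move=> e0 ue /=; have [s1 s2] := sqrt1D_ge u.
rewrite ltr_pdivrMr; last lra.
have : 2 / e < Num.sqrt (1 + cabs u ^+ 2) by lra.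
by rewrite ltr_pdivrMr// mulrC.
Qed.

(** [None] stands for infinity but is also the default for sequences without a limit; at good points
    only the first meaning occurs. *)
Definition sphere_limit (u : nat -> C) : option C :=
  match pselect (exists l, ccvg u l) with
  | left H => Some (projT1 (cid H))
  | right _ => None
  end.

Lemma sphere_limit_some u l : ccvg u l -> sphere_limit u = Some l.
Proof.
move=> H; rewrite /sphere_limit; case: pselect => [H'|[]]; last by exists l.
by case: cid => /= l' Hl'; rewrite (ccvg_unique H Hl').
Qed.

Lemma sphere_limit_none u : (forall B, exists N, forall n, (N <= n)%N -> B <= cabs (u n)) ->
  sphere_limit u = None.
Proof.
move=> H; rewrite /sphere_limit; case: pselect => // -[l Hl]; exfalso.
have [N HN] := Hl 1 ltr01; have [N' HN'] := H (cabs l + 1).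
have := HN _ (leq_maxl N N'); have := HN' _ (leq_maxr N N'); set v := u _.
by have := cabs_sub_ge v l; lra.
Qed.

Lemma good_at_sphere (u : nat -> C -> C) w e : good_at u w -> 0 < e ->
  exists2 d : R, 0 < d & exists N, forall n, (N <= n)%N -> forall x, cabs (x - w) < d ->
    chordal (Some (u n x)) (sphere_limit (fun n => u n x)) < e.
Proof.
move=> + e0; case=> [[d d0 [g Hg]]|[d d0 HB]]; exists d => //.
- have [|N HN] := Hg (e / 4); first by apply: divr_gt0.
  exists N => n Nn x xw; rewrite (@sphere_limit_some _ (g x)).
    by apply: le_lt_trans (chordal_le _ _) _; have := HN n Nn x xw; lra.
  move=> e' e'0; have [|N' HN'] := Hg (e' / 2); first by apply: divr_gt0.
  by exists N' => m Nm; apply: le_lt_trans (HN' m Nm x xw) _; lra.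
- have [N HN] := HB (2 / e + 1); exists N => n Nn x xw.
  rewrite sphere_limit_none; first by apply: chordal_inf => //; apply: HN.
  by move=> B; have [N' HN'] := HB B; exists N' => m Nm; apply: HN'.
Qed.

(** Discs with rational centre and radius 1 / (q + 1) are countable, so the local extractions can be
    diagonalised over their codes; codes of discs that do not fit impose no condition. *)
Lemma good_subsequence (D : set C) k (K : R) (f : nat -> C -> C) :
  (0 < k)%N -> 0 < K -> open D -> (forall n, family_Fk D k K (f n)) ->
  exists2 phi, sincr phi & forall w, D w ->
    exists2 d : R, 0 < d & forall x, x != w -> cabs (x - w) < d -> good_at (f \o phi) x.
Proof.
move=> k0 K0 oD Ff.
pose ctr (i : rat * rat * nat) : C := (ratr i.1.1 +i* ratr i.1.2)%C.
pose rad (i : rat * rat * nat) : R := (i.2.+1%:R)^-1.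
pose fits i := K * rad i <= 1 / 2 /\ forall w, cabs (w - ctr i) <= rad i -> D w.
pose P (j : nat) phi := forall i, unpickle j = Some i -> fits i ->
  forall w, cabs (w - ctr i) < rad i / 16 ->
    exists2 d : R, 0 < d & forall x, x != w -> cabs (x - w) < d -> good_at (f \o phi) x.
have [||phi Hphi HP] := @diagonal_subsequence P.
- move=> j phi Hphi.
  have [[i [ji [Ki Di]]]|H] := pselect (exists i, unpickle j = Some i /\ fits i); last first.
    by exists id => // i ji fi; exfalso; apply: H; exists i.
  have [|||||||psi Hpsi Hg] := @local_dichotomy R (f \o phi) (ctr i) (rad i) K k.
  + by rewrite invr_gt0.
  + by rewrite invf_le1// ler1n.
  + exact: ltW.
  + exact: Ki.
  + exact: k0.
  + by move=> n l w /Di; apply: holo_derive1n => //; have [] := Ff (phi n).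
  + by move=> n w /Di; apply: family_bound (Ff (phi n)).
  by exists psi => // i'; rewrite ji => -[<-] _.
- move=> j phi psi HP Hpsi sub i ji fi w wi.
  have [d d0 Hd] := HP i ji fi w wi; exists d => // x xw xd.
  exact: good_at_esub (Hd x xw xd) sub.
exists phi => // w Dw; have [r r0 Hr] := open_cball oD Dw.
(* With radius t = 1 / (q + 1), a rational centre is taken within t / 16 of w: 2 t <= r keeps the
   disc in D, and K t <= 1 / 2 is the smallness needed by [growth_bound]. *)
have [q [q1 q2]] : exists q : nat, 2 * (q.+1%:R)^-1 <= r /\ K * (q.+1%:R)^-1 <= 1 / 2.
  exists (Num.bound (2 / r + 2 * K)).
  have B0 : 0 <= 2 / r + 2 * K by rewrite addr_ge0 ?divr_ge0 ?mulr_ge0// ltW.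
  have := archi_boundP B0; set q := Num.bound _ => qB.
  have qS : 2 / r + 2 * K < q.+1%:R by apply: lt_le_trans qB _; rewrite ler_nat.
  have r20 : 0 < 2 / r by rewrite divr_gt0.
  split; rewrite ler_pdivrMr//; last lra.
  by rewrite mulrC -ler_pdivrMr//; lra.
have q0 : 0 < (q.+1%:R)^-1 :> R by rewrite invr_gt0.
have [|a [b ab]] := @rational_approx w ((q.+1%:R)^-1 / 16); first by apply: divr_gt0.
apply: (HP (pickle (a, b, q)) (a, b, q)); rewrite ?pickleK// /fits /rad /ctr //=.
split=> // x xc; apply: Hr; have := cabs_trans x (ratr a +i* ratr b)%C w.
rewrite (cabsBC (ratr a +i* ratr b)%C w); set t := _^-1 in q0 q1 q2 ab xc.
by clearbody t; lra.
Qed.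

End QuasiNormality.

Theorem theorem1 (R : realType) (k : nat) (C : R) (D : set (Cplx R)) :
  (2 <= k)%N -> 0 < C -> domain D -> quasi_normal D (family_Fk D k C).
Proof.
move=> k2 C0 [oD _] f Ff.
have [phi Hphi good] := good_subsequence (ltnW k2) C0 oD Ff.
exists phi, [set w | D w /\ ~ good_at (f \o phi) w], (fun x => sphere_limit (fun n => f (phi n) x)).
split=> //.
- move=> z /good [d d0 Hd]; apply/nearCP; exists d => // w wz [_ bad].
  by apply/eqP; apply/negPn/negP => wn; apply: bad; apply: Hd.
move=> K cK KD e e0.
(* The near-covering form of compactness turns the thresholds N valid around each point of K into
   one threshold for all of K. *)
have /compact_near_coveringP cov := cK.
have [|N _ HN] := cov nat \oo (fun n x =>
  chordal (Some (f (phi n) x)) (sphere_limit (fun n => f (phi n) x)) < e) _; last first.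
  by exists N => n Nn z Kz; apply: (HN n).
move=> z /KD [Dz nE].
have gz : good_at (f \o phi) z by apply: contrapT => bad; apply: nE.
have [d d0 [N HN]] := good_at_sphere gz e0.
exists ([set x | cabs (x - z) < d], [set n | (N <= n)%N]) => /=.
  split; first by apply/nearCP; exists d.
  by exists N.
by move=> [x n] /= [xz Nn]; apply: HN.
Qed.
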